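(* Let $L\ge2$. Suppose $\sigma$ is $J_\sigma$-Lipschitz with $\sigma(0)=0$, and $\nu\in\mathcal{P}(\mathcal{X})$ satisfies $\mathbb{E}_{x\sim\nu}\|x\|^2=M_\nu<\infty$. Given any $f\in\mathcal{F}^{(L)}_\infty$ and any $m\ge1$, there exists a function $f_m$ represented by an $L$-layer neural network with width $m$ such that $$\mathbb{E}_{x\sim\nu}\,|f_m(x)-f(x)|^2\le\frac{(L-1)^2\,(J_\sigma)^{2L-2}\,M_\nu\,\big(\mathscr{C}^{(L)}_\infty(f)\big)^2}{m}.$$
   Context: $\mathcal{X} \subset \mathbb{R}^d$ is compact; $\sigma:\mathbb{R}\to\mathbb{R}$ is a fixed activation function; $\|\cdot\|$ is the Euclidean norm; $\mathcal{P}(U)$ is the set of probability measures on $U$. An $L$-layer neural network with width $m$ represents $f_m(x)=\frac1m\sum_{i=1}^m a_i\,\sigma(h_i^{(L-1)}(x))$, where $h_i^{(1)}(x)=z_i^\top x$ and $h_i^{(l+1)}(x)=\frac1m\sum_{j=1}^m W^{(l)}_{i,j}\,\sigma(h_j^{(l)}(x))$ for $1\le l\le L-2$, with arbitrary parameters $z_i\in\mathbb{R}^d$, $W^{(l)}_{i,j},a_i\in\mathbb{R}$. For a probability measure $\mu$ on functions on $\mathcal{X}$, put $\kappa_\mu(x,x') = \int \sigma(h(x))\sigma(h(x'))\,\mu(dh)$ (assumed finite), and let $\mathcal{H}_\mu$ be the reproducing kernel Hilbert space (RKHS) on $\mathcal{X}$ with kernel $\kappa_\mu$. For an RKHS $\mathcal{H}$,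 $\mathcal{P}(\mathcal{H})$ denotes probability measures on functions on $\mathcal{X}$ concentrated on $\mathcal{H}$; for $\mu\in\mathcal{P}(\mathcal{H})$, $\|\mu\|_{\mathcal{H},\infty}$ is the $\mu$-essential supremum of $\|\cdot\|_{\mathcal{H}}$. $\mathcal{H}^{(1)} = \{x\mapsto z^\top x : z\in\mathbb{R}^d\}$ with the inner product inherited from $\mathbb{R}^d$ (the RKHS of the kernel $x^\top x'$). For RKHSs $\mathcal{H},\mathcal{H}'$ on $\mathcal{X}$: $\mathscr{D}_\infty(\mathcal{H},\mathcal{H}') = \inf\{\|\mu\|_{\mathcal{H},\infty} : \mu\in\mathcal{P}(\mathcal{H}),\ \mathcal{H}_\mu=\mathcal{H}'\}$. $\mathscr{D}^{(L)}_\infty(\mathcal{H}) = \inf_{\mathcal{H}^{(2)},\dots,\mathcal{H}^{(L-1)}} \prod_{l=1}^{L-1}\mathscr{D}_\infty(\mathcal{H}^{(l)},\mathcal{H}^{(l+1)})$ with $\mathcal{H}^{(L)}=\mathcal{H}$ and the infimum over RKHSs on $\mathcal{X}$. $\mathscr{C}^{(L)}_\infty(f) = \inf_{\mathcal{H}} \big(\|f\|_{\mathcal{H}}\cdot \mathscr{D}^{(L)}_\infty(\mathcal{H})\big)$ over RKHSs $\mathcal{H}$ on $\mathcal{X}$. Conventions: an infimum over the empty set is $+\infty$, and in products only choices with all factors finite are considered (in particular $f\in\mathcal{H}$). $\mathcal{F}^{(L)}_\infty = \{f : \mathscr{C}^{(L)}_\infty(f)<\infty\}$. *)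

(* Defs.v *)
From HB Require Import structures.
From mathcomp Require Import all_boot all_order all_algebra.
From mathcomp Require Import all_classical all_reals all_analysis ess_sup_inf.

Set Implicit Arguments.
Unset Strict Implicit.
Unset Printing Implicit Defensive.

Import Order.TTheory GRing.Theory Num.Theory.
Import numFieldNormedType.Exports.

Local Open Scope classical_set_scope.
Local Open Scope ring_scope.

(* The library norm on ['rV[R]_d] is the max-norm: it induces the usual topology
   of R^d, but the Euclidean norm has to be defined separately. *)
Definition dotv (R : realType) (d : nat) (u v : 'rV[R]_d) : R :=
  \sum_(k < d) u ord0 k * v ord0 k.

Definition euclid_norm (R : realType) (d : nat) (u : 'rV[R]_d) : R :=
  Num.sqrt (dotv u u).

Definition borel_rV (R : realType) (d : nat) :=
  g_sigma_algebraType (@open 'rV[R]_d).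

(* [preact sigma z W l i] is the pre-activation h_i^(l+1), since the layers of a
   network are numbered from 1; [W l] is the weight matrix W^(l), so the entry
   [W 0] is never used. *)
Fixpoint preact (R : realType) (d m : nat) (sigma : R -> R)
    (z : 'I_m -> 'rV[R]_d) (W : nat -> 'M[R]_m) (l : nat) (i : 'I_m)
    (x : 'rV[R]_d) : R :=
  match l with
  | 0 => dotv (z i) x
  | k.+1 => m%:R^-1 * \sum_(j < m) W k.+1 i j * sigma (preact sigma z W k j x)
  end.

(* [g] is represented by an [L]-layer network of width [m], for [2 <= L]. *)
Definition is_network (R : realType) (d : nat) (sigma : R -> R) (L m : nat)
    (g : 'rV[R]_d -> R) : Prop :=
  exists (z : 'I_m -> 'rV[R]_d) (W : nat -> 'M[R]_m) (a : 'I_m -> R),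
    forall x, g x = m%:R^-1 * \sum_(i < m) a i * sigma (preact sigma z W L.-2 i x).

(* Real RKHSs on [T]: Hilbert spaces of functions on [T] whose evaluation
   functionals are bounded.  [ip] is only meaningful on [carrier]. *)
Record rkhs (R : realType) (T : Type) := Rkhs {
  carrier : set (T -> R);
  ip : (T -> R) -> (T -> R) -> R;
  rkhs_norm := fun f => Num.sqrt (ip f f);
  rkhs0 : carrier 0;
  rkhs_lin : forall (a : R) f g, carrier f -> carrier g -> carrier (a *: f + g);
  ip_sym : forall f g, carrier f -> carrier g -> ip f g = ip g f;
  ip_lin : forall (a : R) f g h, carrier f -> carrier g -> carrier h ->
    ip (a *: f + g) h = a * ip f h + ip g h;
  ip_ge0 : forall f, carrier f -> 0 <= ip f f;
  ip_eq0 : forall f, carrier f -> ip f f = 0 -> f = 0;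
  rkhs_complete : forall u : nat -> T -> R,
    (forall n, carrier (u n)) ->
    (forall e : R, 0 < e -> exists N : nat, forall p q : nat,
       (N <= p)%N -> (N <= q)%N -> rkhs_norm (u p - u q) < e) ->
    exists2 f, carrier f & (fun n => rkhs_norm (u n - f)) @ \oo --> (0 : R);
  eval_bounded : forall x : T, exists c : R,
    forall f, carrier f -> `|f x| <= c * rkhs_norm f
}.

Arguments rkhs_norm {R T}.

(* [H] is the RKHS with kernel [kappa]; by Moore-Aronszajn, this determines the
   Hilbert space [H] (its elements and its inner product on them). *)
Definition has_kernel (R : realType) (T : Type) (H : rkhs R T)
    (kappa : T -> T -> R) : Prop :=
  forall x, carrier H (kappa ^~ x) /\
    forall f, carrier H f -> ip H f (kappa ^~ x) = f x.

(* Probability measures concentrated on [H] are probability measures on the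
   subtype of the elements of [H], for the sigma-algebra generated by the
   evaluations.  (In the product sigma-algebra of [T -> R] a space of continuous
   functions is in general not measurable, and contains no measurable set of
   full measure.)  When [H] is separable, this is its Borel sigma-algebra. *)
Definition rkhs_elt (R : realType) (T : Type) (H : rkhs R T) : Type :=
  set_type (carrier H).

HB.instance Definition _ (R : realType) (T : Type) (H : rkhs R T) :=
  Choice.copy (rkhs_elt H) (set_type (carrier H)).
HB.instance Definition _ (R : realType) (T : Type) (H : rkhs R T) :=
  isPointed.Build (rkhs_elt H) (exist _ 0 (mem_set (rkhs0 H))).

Definition evaluation_sets (R : realType) (T : Type) (H : rkhs R T) :
    set (set (rkhs_elt H)) :=
  \bigcup_(x in [set: T])
    preimage_set_system [set: rkhs_elt H] (fun h => sval h x)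
      (@measurable _ (measurableTypeR R)).

Definition rkhs_space (R : realType) (T : Type) (H : rkhs R T) :=
  g_sigma_algebraType (@evaluation_sets R T H).

Definition rkhs_ess_norm (R : realType) (T : Type) (H : rkhs R T)
    (mu : probability (rkhs_space H) R) : \bar R :=
  ess_sup mu (fun h : rkhs_space H => (rkhs_norm H (sval h))%:E).

Definition kappa_finite (R : realType) (T : Type) (sigma : R -> R) (H : rkhs R T)
    (mu : probability (rkhs_space H) R) : Prop :=
  forall x x', mu.-integrable [set: rkhs_space H]
    (fun h => (sigma (sval h x) * sigma (sval h x'))%:E).

Definition kappa (R : realType) (T : Type) (sigma : R -> R) (H : rkhs R T)
    (mu : probability (rkhs_space H) R) (x x' : T) : R :=
  \int[mu]_(h in [set: rkhs_space H]) (sigma (sval h x) * sigma (sval h x')).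

Definition D_infty (R : realType) (T : Type) (sigma : R -> R)
    (H H' : rkhs R T) : \bar R :=
  ereal_inf [set rkhs_ess_norm mu | mu in
    [set mu : probability (rkhs_space H) R |
      kappa_finite sigma mu /\ has_kernel H' (kappa sigma mu)]].

(* Linear functions on [X].  When [X] does not span R^d, several [z] may define
   the same function on [X], and the inner product inherited from R^d is the one
   of the minimal-norm representatives; it is pinned down by the kernel. *)
Definition is_linear_rkhs (R : realType) (d : nat) (X : set 'rV[R]_d)
    (H : rkhs R X) : Prop :=
  carrier H = [set f | exists z : 'rV[R]_d, f = fun x : X => dotv z (set_val x)]
  /\ has_kernel H (fun x x' : X => dotv (set_val x) (set_val x')).

(* The infimum only ranges over the ladders all of whose factors are finite. *)
Definition D_ladder (R : realType) (d : nat) (X : set 'rV[R]_d) (sigma : R -> R)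
    (L : nat) (H : rkhs R X) : \bar R :=
  ereal_inf [set (\prod_(1 <= l < L) D_infty sigma (Hs l) (Hs l.+1))%E | Hs in
    [set Hs : nat -> rkhs R X |
      [/\ is_linear_rkhs (Hs 1%N), Hs L = H &
          forall l, (1 <= l < L)%N ->
            (D_infty sigma (Hs l) (Hs l.+1) < +oo)%E]]].

Definition C_infty (R : realType) (d : nat) (X : set 'rV[R]_d) (sigma : R -> R)
    (L : nat) (f : X -> R) : \bar R :=
  ereal_inf [set ((rkhs_norm H f)%:E * D_ladder sigma L H)%E | H in
    [set H : rkhs R X | carrier H f /\ (D_ladder sigma L H < +oo)%E]].

Definition F_infty (R : realType) (d : nat) (X : set 'rV[R]_d) (sigma : R -> R)
    (L : nat) : set (X -> R) :=
  [set f | (C_infty sigma L f < +oo)%E].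

(* Main.v *)
(* Maurey's sampling argument, made deterministic and applied layer by layer from
   the top.  If [H'] has the kernel of [mu] on [H], a function [h] of [H'] is, up
   to a small uniform error, [h x = \int a(g) sigma(g x) mu(dg)] with [a] of
   L2-norm at most the norm of [h], and [m] functions [g] drawn from [mu]
   approximate it in L2([nu]) with squared error (J^2 D^2 G M |h|^2 - |h|_nu^2) / m.
   Instead of drawing them independently, they are chosen one after the other:
   for each choice there is a [g] that does at least as well as the mean, for a
   potential which adds to the sampling errors of all the [m] units a multiple of
   the squared coefficients [a(g)^2].  These are the weights with which the errors
   of the layers below are inherited.  With [(x + y)^2 <= (1 + t) x^2 + (1 + 1/t) y^2]
   and [t] close to [k], the constants [k^2] of the successive layers reproduce
   themselves as [k^2 + 2k + 1].

   The infima that define [C_infty] need not be attained and the representation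
   of [h] is only approximate; the losses are absorbed by the negative variance
   term -|f|_nu^2, unless [f] vanishes [nu]-almost everywhere, when the zero
   network does.

   The balls of all the spaces of a ladder are equi-Lipschitz, which gives the
   measurability of the evaluation [(g, x) -> g x] that Tonelli's theorem needs,
   and a uniform approximation of [h] by its minimal-norm interpolant on a finite
   net, for which [a] is an explicit finite sum. *)

Require Import Defs.
From HB Require Import structures.
From mathcomp Require Import all_boot all_order all_algebra.
From mathcomp Require Import all_classical all_reals all_analysis ess_sup_inf
  measurable_realfun.
From mathcomp Require Import ring lra.

Set Implicit Arguments.
Unset Strict Implicit.
Unset Printing Implicit Defensive.

Import Order.TTheory GRing.Theory Num.Theory.
Import numFieldNormedType.Exports.

Local Open Scope classical_set_scope.
Local Open Scope ring_scope.

(** * Inner products and interpolation in an RKHS *)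

Section RkhsAlgebra.
Context (R : realType) (T : Type) (H : rkhs R T).
Implicit Types (f g h : T -> R) (a : R).

Local Notation carrier := (carrier H).
Local Notation ip := (ip H).

Lemma carrierD f g : carrier f -> carrier g -> carrier (f + g).
Proof. by move=> Hf Hg; rewrite -[f]scale1r; exact: rkhs_lin. Qed.

Lemma carrierZ a f : carrier f -> carrier (a *: f).
Proof. by move=> Hf; rewrite -[_ *: _]addr0; apply: rkhs_lin => //; exact: rkhs0. Qed.

Lemma carrierB f g : carrier f -> carrier g -> carrier (f - g).
Proof. by move=> Hf Hg; rewrite addrC -scaleN1r; exact: rkhs_lin. Qed.

Lemma carrier_sum n (c : nat -> R) (v : nat -> T -> R) :
  (forall k, carrier (v k)) -> carrier (\sum_(k < n) c k *: v k).
Proof.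
move=> Hv; elim/big_ind: _ => //; first exact: rkhs0.
- exact: carrierD.
- by move=> i _; exact: carrierZ.
Qed.

Lemma ipDl f g h : carrier f -> carrier g -> carrier h ->
  ip (f + g) h = ip f h + ip g h.
Proof. by move=> *; rewrite -[f in LHS]scale1r ip_lin// mul1r. Qed.

Lemma ip0l h : carrier h -> ip 0 h = 0.
Proof.
move=> Hh; have H0 := rkhs0 H.
by have := ipDl H0 H0 Hh; rewrite addr0; lra.
Qed.

Lemma ipZl a f h : carrier f -> carrier h -> ip (a *: f) h = a * ip f h.
Proof.
by move=> *; rewrite -[_ *: _]addr0 ip_lin// ?ip0l ?addr0//; exact: rkhs0.
Qed.

Lemma ipBl f g h : carrier f -> carrier g -> carrier h ->
  ip (f - g) h = ip f h - ip g h.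
Proof. by move=> *; rewrite addrC -scaleN1r ip_lin// mulN1r addrC. Qed.

Lemma ipZr a f h : carrier f -> carrier h -> ip f (a *: h) = a * ip f h.
Proof.
by move=> *; rewrite (ip_sym) ?ipZl 1?(ip_sym (f := f))//; exact: carrierZ.
Qed.

Lemma ipBr f g h : carrier f -> carrier g -> carrier h ->
  ip f (g - h) = ip f g - ip f h.
Proof.
move=> Hf Hg Hh; rewrite (ip_sym Hf) ?ipBl ?(ip_sym (f := f))//.
exact: carrierB.
Qed.

Lemma ip_suml n (c : nat -> R) (v : nat -> T -> R) h :
  (forall k, carrier (v k)) -> carrier h ->
  ip (\sum_(k < n) c k *: v k) h = \sum_(k < n) c k * ip (v k) h.
Proof.
move=> Hv Hh; elim: n => [|n IH]; first by rewrite !big_ord0 ip0l.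
rewrite !big_ord_recr/= ipDl ?IH ?ipZl//; first exact: carrier_sum.
exact: carrierZ.
Qed.

Lemma ip_cauchy f g : carrier f -> carrier g ->
  ip f g ^+ 2 <= ip f f * ip g g.
Proof.
move=> Hf Hg; have gg := ip_ge0 Hg.
have [/eqP gg0|gg0] := boolP (ip g g == 0).
  have -> : g = 0 by exact: (ip_eq0 Hg gg0).
  rewrite (ip_sym Hf (rkhs0 H)) !ip0l//; last exact: rkhs0.
  by rewrite mulr0 expr0n.
have {}gg : 0 < ip g g by rewrite lt_neqAle eq_sym gg0.
have Hl : carrier (ip f g / ip g g *: g) by exact: carrierZ.
have := ip_ge0 (carrierB Hf Hl).
rewrite ipBl ?ipBr ?ipZl ?ipZr ?(ip_sym Hg Hf)//; last exact: carrierB.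
have -> (x y z : R) : x - y / z * y - (y / z * y - y / z * (y / z * z)) =
    x - y / z * y + y / z * (y / z * z - y) by ring.
by rewrite divfK// subrr mulr0 addr0 subr_ge0 mulrAC ler_pdivrMr// -expr2.
Qed.

Lemma rkhs_normE f : carrier f -> rkhs_norm H f ^+ 2 = ip f f.
Proof. by move=> Hf; rewrite sqr_sqrtr// ip_ge0. Qed.

(** Gram-Schmidt by induction on [n]: the projection of [h] is corrected along the residual [r] of
    [v n], itself obtained from the induction hypothesis. The family need not be independent, which
    is what interpolation at repeated points requires. *)
Lemma orthogonal_projection (v : nat -> T -> R) n h :
  (forall k, carrier (v k)) -> carrier h ->
  exists c : nat -> R,
    forall j, (j < n)%N -> ip (h - \sum_(k < n) c k *: v k) (v j) = 0.
Proof.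
move=> Hv; elim: n h => [|n IH] h Hh; first by exists (fun=> 0).
have [c hc] := IH h Hh; have [e he] := IH _ (Hv n).
set s := \sum_(k < n) c k *: v k in hc; set s' := \sum_(k < n) e k *: v k in he.
have Hs : carrier s by exact: carrier_sum.
have Hs' : carrier s' by exact: carrier_sum.
pose r := v n - s'; have Hr : carrier r by exact: carrierB.
have rs' : ip r s' = 0.
  by rewrite ip_sym// ip_suml// big1// => i _; rewrite ip_sym// he ?mulr0.
have rv : ip r (v n) = ip r r by rewrite {3}/r ipBr// rs' subr0.
pose l := ip (h - s) (v n) / ip r r.
exists (fun k => if k == n then l else c k - l * e k) => j jn.
rewrite big_ord_recr/= eqxx.
have -> : \sum_(k < n) (if k == n :> nat then l else c k - l * e k) *: v k
    = s - l *: s'.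
  rewrite /s /s' scaler_sumr -sumrB; apply: eq_bigr => i _.
  by rewrite (ltn_eqF (ltn_ord i)) scalerBl scalerA.
have -> : h - (s - l *: s' + l *: v n) = (h - s) - l *: r.
  by rewrite /r scalerBr !opprD !opprK !addrA -addrA [l *: s' - _]addrC addrA.
have Hhs : carrier (h - s) by exact: carrierB.
rewrite ipBl ?ipZl//; last exact: carrierZ.
move: jn; rewrite ltnS leq_eqVlt => /orP[/eqP->|jn]; last first.
  by rewrite hc// he// mulr0 subrr.
(* If the residual vanishes, [v n] lies in the span of the earlier vectors, to which [h - s] is
   already orthogonal. *)
rewrite rv /l; have [r0|r0] := eqVneq (ip r r) 0; last by rewrite divfK ?subrr.
have vs : v n = s'.
  have : v n - s' = 0 by exact: (ip_eq0 Hr r0).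
  by move/eqP; rewrite subr_eq0 => /eqP.
rewrite r0 mulr0 subr0 vs ip_sym// ip_suml// big1// => i _.
by rewrite ip_sym// hc ?mulr0.
Qed.

Lemma eval_sum n (c : nat -> R) (v : nat -> T -> R) x :
  (\sum_(k < n) c k *: v k) x = \sum_(k < n) c k * v k x.
Proof. by rewrite fct_sumE. Qed.

(** The interpolant is the projection on the span of the kernel sections at the points: by the
    reproducing property, orthogonality of [h - s] to a section is agreement at its point, and a
    projection does not increase the norm. *)
Lemma interpolation (K : T -> T -> R) (p : nat -> T) n h :
  has_kernel H K -> carrier h ->
  exists c : nat -> R, let s := \sum_(k < n) c k *: K ^~ (p k) in
    [/\ carrier s, forall k, (k < n)%N -> s (p k) = h (p k) &
        ip s s <= ip h h].
Proof.
move=> HK Hh; have Hv k : carrier (K ^~ (p k)) by have [] := HK (p k).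
have [c hc] := orthogonal_projection n Hv Hh.
exists c => s; have Hs : carrier s by exact: (@carrier_sum n c (fun k => K ^~ (p k))).
have Hhs : carrier (h - s) by exact: carrierB.
split => // [k kn|].
  have := hc k kn; rewrite ipBl//.
  have [_ evk] := HK (p k); rewrite !evk// => /eqP; rewrite subr_eq0 => /eqP //.
have sh0 : ip s (h - s) = 0.
  by rewrite (@ip_suml n c (fun k => K ^~ (p k)))// big1// => i _; rewrite ip_sym// hc ?mulr0.
have := ip_ge0 Hhs; rewrite ipBl// sh0 subr0 ipBr//.
move: sh0; rewrite ipBr// => /eqP; rewrite subr_eq0 => /eqP <-.
by rewrite (ip_sym Hh Hs) subr_ge0.
Qed.

Lemma eval_le (K : T -> T -> R) h x : has_kernel H K -> carrier h ->
  h x ^+ 2 <= ip h h * K x x.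
Proof.
move=> HK Hh; have [Hx ex] := HK x; rewrite -ex//.
by have <- : ip (K ^~ x) (K ^~ x) = K x x; [exact: ex|exact: ip_cauchy].
Qed.

(** Cauchy-Schwarz against the difference of two kernel sections, whose squared norm is the last
    factor. *)
Lemma eval_dist_le (K : T -> T -> R) h x y : has_kernel H K -> carrier h ->
  (h x - h y) ^+ 2 <= ip h h * (K x x - K x y - K y x + K y y).
Proof.
move=> HK Hh; have [Hx ex] := HK x; have [Hy ey] := HK y.
rewrite -ex// -ey// -ipBr//; apply: (le_trans (ip_cauchy Hh (carrierB Hx Hy))).
rewrite ipBl ?ipBr//; last exact: carrierB.
rewrite (ex _ Hx) (ey _ Hx) (ex _ Hy) (ey _ Hy).
by apply: ler_wpM2l; [exact: ip_ge0|lra].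
Qed.

End RkhsAlgebra.

(** * Greedy sampling *)

Section Sampling.
Context d1 (T1 : measurableType d1) (R : realType) (mu : probability T1 R).

Lemma ae_exists (P : set T1) : (\forall g \ae mu, P g) -> exists g, P g.
Proof.
move=> aeP.
have pf : ProperFilter (almost_everywhere mu).
  apply: ae_properfilter_algebraOfSetsType.
  exact: (eq_ind_r (fun z => 0 < z)%E lte01 (probability_setT mu)).
by have [g Pg] := filter_ex aeP; exists g.
Qed.

(** Otherwise [F] minus its finite mean would be positive almost everywhere with integral zero; an
    infinite mean is no constraint. The set [P] lets the chosen point keep almost sure
    properties. *)
Lemma exists_le_integral (F : T1 -> \bar R) (P : set T1) :
  measurable_fun setT F -> (forall g, 0 <= F g)%E ->
  (\forall g \ae mu, P g) -> exists2 g, P g & (F g <= \int[mu]_y F y)%E.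
Proof.
move=> mF F0 aeP.
have : (\int[mu]_y F y)%E != -oo%E.
  by rewrite gt_eqF// (lt_le_trans ltNy0)// integral_ge0.
case E : (\int[mu]_y F y)%E => [c| |] // _; last first.
  by have [g Pg] := ae_exists aeP; exists g => //; rewrite leey.
apply: contrapT => nP.
have {nP} FP g : P g -> (c%:E < F g)%E.
  by move=> Pg; rewrite ltNge; apply/negP => Fg; apply: nP; exists g.
have aec : \forall g \ae mu, (c%:E < F g)%E by apply: filterS aeP => g /FP.
have iF : mu.-integrable setT F.
  apply/integrableP; split => //.
  by under eq_integral do rewrite gee0_abs//; rewrite E ltry.
have ic : mu.-integrable setT (cst c%:E) by exact: finite_measure_integrable_cst.
pose D := (F \- cst c%:E)%E.
have D0 : (\int[mu]_y `|D y| = 0)%E.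
  transitivity (\int[mu]_y D y)%E; last first.
    rewrite integralB// E integral_cst//= [mu _]probability_setT mule1.
    by rewrite subee.
  apply: ae_eq_integral => //.
  - by apply: measurableT_comp => //; exact: emeasurable_funB.
  - exact: emeasurable_funB.
  - apply: filterS aec => g cF _.
    by rewrite gee0_abs// /D sube_ge0// ltW.
have := (ae_eq_integral_abs mu measurableT (emeasurable_funB mF (measurable_cst _))).1 D0.
move=> aeD; have [g [/=]] := ae_exists (filterI aec aeD).
move=> cF /(_ I) Dg; move: cF (Dg : (F g - c%:E = 0)%E).
case: (F g) => [r| |] //; rewrite lte_fin -EFinB => cr [rc].
by move: cr; rewrite -subr_gt0 rc ltxx.
Qed.

(** Bias and variance: the shifted variable has mean [a], and [U - t ^+ 2] is the variance of
    [u]. *)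
Lemma second_moment_shift (u : T1 -> R) (a t U : R) :
  mu.-integrable setT (EFin \o u) -> (\int[mu]_y (u y)%:E = t%:E)%E ->
  (\int[mu]_y (u y ^+ 2)%:E = U%:E)%E ->
  (\int[mu]_y ((a + (u y - t)) ^+ 2)%:E = (a ^+ 2 - t ^+ 2 + U)%:E)%E.
Proof.
move=> iu ut uU.
have mu_ : measurable_fun setT u by apply/measurable_EFinP; exact: measurable_int iu.
have iu2 : mu.-integrable setT (EFin \o (fun y => u y ^+ 2)).
  apply/integrableP; split.
    by apply/measurable_EFinP; exact: measurable_funX.
  under eq_integral do rewrite /= ger0_norm ?sqr_ge0//.
  by rewrite uU ltry.
have icst r : mu.-integrable setT (EFin \o (cst r : T1 -> R)).
  exact: finite_measure_integrable_cst.
have ilin : mu.-integrable setT (EFin \o (fun y => 2 * (a - t) * u y)).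
  rewrite (_ : EFin \o _ = fun y => ((2 * (a - t))%:E * (u y)%:E)%E).
    exact: integrableZl.
  by apply/funext => y; rewrite /= EFinM.
transitivity (\int[mu]_y (((a - t) ^+ 2)%:E + ((2 * (a - t) * u y)%:E + (u y ^+ 2)%:E)))%E.
  by apply: eq_integral => y _; rewrite -!EFinD; congr (_%:E); ring.
rewrite integralD//; [|exact: icst|exact: integrableD].
rewrite integralD// uU integral_cst//=.
under [X in (_ + (X + _))%E]eq_integral do rewrite EFinM.
rewrite integralZl// ut [mu _]probability_setT mule1 -EFinM -!EFinD.
by congr (_%:E); ring.
Qed.

End Sampling.

Lemma integral_wsum d (T : measurableType d) (R : realType)
    (mu : {measure set T -> \bar R}) (D : set T) n (w : 'I_n -> R)
    (f : 'I_n -> T -> R) : measurable D ->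
  (forall i, 0 <= w i) -> (forall i, measurable_fun D (f i)) ->
  (forall i y, D y -> 0 <= f i y) ->
  (\int[mu]_(y in D) (\sum_i w i * f i y)%:E =
   \sum_i (w i)%:E * \int[mu]_(y in D) (f i y)%:E)%E.
Proof.
move=> mD w0 mf f0.
under eq_integral do rewrite -sumEFin.
rewrite ge0_integral_sum//; last 2 first.
- move=> i; apply/measurable_EFinP; apply: measurable_funM => //.
- by move=> i y Dy; rewrite lee_fin mulr_ge0// f0.
apply: eq_bigr => i _; under eq_integral do rewrite EFinM.
rewrite ge0_integralZl_EFin//; first by move=> y Dy; rewrite lee_fin f0.
exact/measurable_EFinP.
Qed.

Section Greedy.
Context d1 d2 (T1 : measurableType d1) (T2 : measurableType d2) (R : realType).
Variables (mu : probability T1 R) (nu : probability T2 R).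
Variables (n : nat) (w : 'I_n -> R) (u : 'I_n -> T1 -> T2 -> R).
Variables (t : 'I_n -> T2 -> R) (v : T1 -> R) (P : set T1) (U V : R).
Hypothesis w0 : forall i, 0 <= w i.
Hypothesis mu_u : forall i, measurable_fun setT (fun p : T1 * T2 => u i p.1 p.2).
Hypothesis mt : forall i, measurable_fun setT (t i).
Hypothesis iu : forall i x, mu.-integrable setT (EFin \o u i ^~ x).
Hypothesis iu2 : forall i x,
  mu.-integrable setT (EFin \o (fun g => u i g x ^+ 2)).
Hypothesis ut : forall i x, (\int[mu]_g (u i g x)%:E = (t i x)%:E)%E.
Hypothesis mv : measurable_fun setT v.
Hypothesis v0 : forall g, 0 <= v g.
Hypothesis aeP : \forall g \ae mu, P g.
Hypothesis leU :
  (\int[nu]_x \int[mu]_g (\sum_i w i * u i g x ^+ 2)%:E <= U%:E)%E.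
Hypothesis leV : (\int[mu]_g (v g)%:E <= V%:E)%E.

Let q (a : 'I_n -> T2 -> R) g x := \sum_i w i * (a i x + (u i g x - t i x)) ^+ 2.
Let s x := \sum_i w i * t i x ^+ 2.

Let s0 x : 0 <= s x.
Proof. by apply: sumr_ge0 => i _; rewrite mulr_ge0// sqr_ge0. Qed.

Let ms : measurable_fun setT s.
Proof.
apply: measurable_sum => i; apply: measurable_funM => //.
exact: measurable_funX.
Qed.

Let mu_g i g : measurable_fun setT (u i g).
Proof. exact: (measurableT_comp (mu_u i) (pair1_measurable g)). Qed.

Let mu_x i x : measurable_fun setT (u i ^~ x).
Proof. by apply/measurable_EFinP; exact: measurable_int (iu i x). Qed.

Let q0 a g x : 0 <= q a g x.
Proof. by apply: sumr_ge0 => i _; rewrite mulr_ge0// sqr_ge0. Qed.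

(** The variance term [s] is kept on the left, so that no extended reals are subtracted. *)
Let mean_q a x : (\int[mu]_g (q a g x)%:E + (s x)%:E =
  (\sum_i w i * a i x ^+ 2)%:E + \int[mu]_g (\sum_i w i * u i g x ^+ 2)%:E)%E.
Proof.
rewrite /q !integral_wsum//; last 4 first.
- by move=> i; exact: measurable_funX.
- by move=> i y _; rewrite sqr_ge0.
- move=> i; apply: measurable_funX; apply: measurable_funD => //.
  exact: measurable_funB.
- by move=> i y _; rewrite sqr_ge0.
rewrite /s -!sumEFin -!big_split/=; apply: eq_bigr => i _.
have /fineK : (\int[mu]_g (u i g x ^+ 2)%:E)%E \is a fin_num.
  exact: integrable_fin_num (iu2 i x).
set W := fine _ => WE.
rewrite (second_moment_shift _ (iu i x) (ut i x) (esym WE)) -WE.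
by rewrite -!EFinM -!EFinD; congr (_%:E); ring.
Qed.

Let mq a : (forall i, measurable_fun setT (a i)) ->
  measurable_fun setT (fun p : T1 * T2 => q a p.1 p.2).
Proof.
move=> ma; apply: measurable_sum => i; apply: measurable_funM => //.
apply: measurable_funX; apply: measurable_funD.
  exact: measurableT_comp.
apply: measurable_funB; first exact: mu_u.
exact: measurableT_comp.
Qed.

(** Here [a] is the error accumulated by the units already chosen. By Tonelli and [mean_q], the left
    side averaged over [g] is at most the right side, and some [g] in [P] does no worse than the
    average. *)
Lemma greedy_step (a : 'I_n -> T2 -> R) : (forall i, measurable_fun setT (a i)) ->
  exists2 g, P g &
   (\int[nu]_x (\sum_i w i * (a i x + (u i g x - t i x)) ^+ 2)%:E + (v g)%:E +
    \int[nu]_x (\sum_i w i * t i x ^+ 2)%:E <=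
    \int[nu]_x (\sum_i w i * a i x ^+ 2)%:E + (U + V)%:E)%E.
Proof.
move=> ma.
pose F g := (\int[nu]_x (q a g x)%:E + (v g)%:E)%E.
have mqE : measurable_fun setT (fun p : T1 * T2 => (q a p.1 p.2)%:E).
  by apply/measurable_EFinP; exact: mq.
have mF1 : measurable_fun setT (fun g => \int[nu]_x (q a g x)%:E)%E.
  apply: (@measurable_fun_fubini_tonelli_F _ _ _ _ _ nu (fun p => (q a p.1 p.2)%:E)) => //.
  by move=> p; rewrite lee_fin.
have mF2 : measurable_fun setT (fun x => \int[mu]_g (q a g x)%:E)%E.
  apply: (@measurable_fun_fubini_tonelli_G _ _ _ _ _ mu (fun p => (q a p.1 p.2)%:E)) => //.
  by move=> p; rewrite lee_fin.
have mF : measurable_fun setT F.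
  by apply: emeasurable_funD => //; exact/measurable_EFinP.
have F0 g : (0 <= F g)%E.
  by rewrite adde_ge0 ?lee_fin// integral_ge0// => x _; rewrite lee_fin.
have [g Pg Fg] := exists_le_integral mF F0 aeP; exists g => //.
rewrite -/(F g) -/s; apply: (le_trans (leeD2r _ Fg)).
rewrite /F ge0_integralD//; last 3 first.
- by move=> y _; rewrite integral_ge0// => x _; rewrite lee_fin.
- by move=> y _; rewrite lee_fin.
- exact/measurable_EFinP.
rewrite (@fubini_tonelli _ _ _ _ _ mu nu (fun p => (q a p.1 p.2)%:E))//=; last first.
  by move=> p; rewrite lee_fin.
rewrite addeAC -ge0_integralD//; last 3 first.
- by move=> y _; rewrite integral_ge0// => x _; rewrite lee_fin.
- by move=> y _; rewrite lee_fin; exact: s0.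
- by apply/measurable_EFinP; exact: ms.
under eq_integral do rewrite mean_q.
rewrite ge0_integralD//; last 4 first.
- move=> y _; rewrite lee_fin; apply: sumr_ge0 => i _.
  by rewrite mulr_ge0// sqr_ge0.
- apply/measurable_EFinP; apply: measurable_sum => i; apply: measurable_funM => //.
  exact: measurable_funX.
- move=> y _; apply: integral_ge0 => x _; rewrite /= lee_fin; apply: sumr_ge0 => i _.
  by rewrite mulr_ge0// sqr_ge0.
- apply: (@measurable_fun_fubini_tonelli_G _ _ _ _ _ mu
    (fun p : T1 * T2 => (\sum_i w i * u i p.1 p.2 ^+ 2)%:E)) => //.
    apply/measurable_EFinP; apply: measurable_sum => i.
    by apply: measurable_funM => //; exact: measurable_funX.
  move=> p; rewrite lee_fin; apply: sumr_ge0 => i _.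
  by rewrite mulr_ge0// sqr_ge0.
by rewrite -addeA leeD2l// EFinD leeD.
Qed.

(** The greedy steps add up. On average a centred new term has no cross term with the accumulated
    error, so the squared error grows like [k], as for independent draws, and not like the square of
    [k]. *)
Lemma greedy_sampling k : exists g : nat -> T1, (forall j, P (g j)) /\
  (\int[nu]_x (\sum_i w i * (\sum_(j < k) (u i (g j) x - t i x)) ^+ 2)%:E +
   (\sum_(j < k) v (g j))%:E +
   k%:R%:E * \int[nu]_x (\sum_i w i * t i x ^+ 2)%:E <= (k%:R * (U + V))%:E)%E.
Proof.
elim: k => [|k [g [Pg Hg]]].
  have [g0 Pg0] := ae_exists aeP; exists (fun=> g0); split => //.
  rewrite !mul0r mul0e big_ord0 !adde0.
  under eq_integral do (under eq_bigr do rewrite big_ord0 expr0n mulr0;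
    rewrite big1//).
  by rewrite integral0.
pose a i x := \sum_(j < k) (u i (g j) x - t i x).
have ma i : measurable_fun setT (a i).
  by apply: measurable_sum => j; exact: measurable_funB.
have [g1 Pg1 Hg1] := greedy_step ma.
exists (fun j => if j == k then g1 else g j); split; first by move=> j; case: ifP.
have E (f : T1 -> R) : \sum_(j < k.+1) f (if j == k :> nat then g1 else g j) =
    \sum_(j < k) f (g j) + f g1.
  rewrite big_ord_recr/= eqxx; congr (_ + _).
  by apply: eq_bigr => j _; rewrite (ltn_eqF (ltn_ord j)).
rewrite E.
under eq_integral do under eq_bigr do rewrite (E (fun y => u _ y _ - t _ _)).
rewrite -(natr1 k) [((_ + 1)%:E)]EFinD ge0_muleDl ?lee_fin// mul1e.
rewrite mulrDl mul1r [((_ * _ + _)%:E)]EFinD.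
move: Hg Hg1; rewrite -/a.
set I1 := (\int[nu]_x _)%E; set I2 := (\int[nu]_x _)%E.
set I3 := (\int[nu]_x _)%E => Hg Hg1.
set S := \sum_(j < k) v (g j) in Hg *; rewrite EFinD.
clearbody I1 I2 I3 S.
have -> : (I3 + (S%:E + (v g1)%:E) + (k%:R%:E * I2 + I2) =
    I3 + (v g1)%:E + I2 + (S%:E + k%:R%:E * I2))%E.
  rewrite [(S%:E + (v g1)%:E)%E]addeC -!addeA.
  by congr (_ + (_ + _))%E; rewrite addeA addeC.
apply: le_trans (leeD2r _ Hg); apply: le_trans (leeD2r _ Hg1) _.
by rewrite -!addeA leeD2l// addeC addeA.
Qed.

End Greedy.

(** * Joint measurability of evaluation *)

Section EuclideanSpace.
Context (R : realType) (d : nat).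
Implicit Types (x y : 'rV[R]_d).

Lemma dotv_ge0 x : 0 <= dotv x x.
Proof. by apply: sumr_ge0 => i _; rewrite -expr2 sqr_ge0. Qed.

Lemma dotv_sub x y :
  dotv (x - y) (x - y) = dotv x x - dotv x y - dotv y x + dotv y y.
Proof.
rewrite /dotv -!sumrB -big_split/=; apply: eq_bigr => i _.
by rewrite !mxE; ring.
Qed.

(** The balls are those of the max-norm, hence the factor [d]. *)
Lemma ball_dotv x y (e : R) : ball x e y -> dotv (y - x) (y - x) <= d%:R * e ^+ 2.
Proof.
move=> bxy; have -> : d%:R * e ^+ 2 = \sum_(k < d) e ^+ 2.
  by rewrite sumr_const card_ord mulr_natl.
apply: ler_sum => i _; have [_ /(_ ord0 i)] := bxy; rewrite /ball/= !mxE => h.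
rewrite -expr2 -[leLHS]real_normK ?num_real// ler_sqr ?nnegrE//.
  by rewrite distrC ltW.
exact: le_trans (ltW h).
Qed.

Lemma open_borel (A : set 'rV[R]_d) : open A -> measurable (A : set (borel_rV R d)).
Proof. by move=> oA; exact: sub_gen_smallest. Qed.

Lemma continuous_borel (f : 'rV[R]_d -> R) :
  continuous f -> measurable_fun setT (f : borel_rV R d -> R).
Proof.
move=> cf; apply: (measurability _ (RGenOpens.measurableE R)).
move=> _ [_ [a [b ->] <-]]; rewrite setTI; apply: open_borel.
by move/continuousP: cf; apply; exact: interval_open.
Qed.

Lemma measurable_coord k : measurable_fun setT (fun x : borel_rV R d => x ord0 k).
Proof. by apply: continuous_borel => x; exact: coord_continuous. Qed.

Lemma measurable_dotv z : measurable_fun setT (fun x : borel_rV R d => dotv z x).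
Proof.
apply: measurable_sum => k; apply: measurable_funM => //.
exact: measurable_coord.
Qed.

Lemma measurable_dotvv : measurable_fun setT (fun x : borel_rV R d => dotv x x).
Proof.
by apply: measurable_sum => k; apply: measurable_funM; exact: measurable_coord.
Qed.

Lemma compact_borel (X : set 'rV[R]_d) : compact X -> measurable (X : set (borel_rV R d)).
Proof.
move=> cX; have cl : closed X by apply: compact_closed => //; exact: norm_hausdorff.
rewrite -(setCK X); apply: measurableC; apply: open_borel.
exact: closed_openC.
Qed.

(** The net consists of points of [X], where functions on [X] can be evaluated; interiors of balls
    form the open cover. *)
Lemma compact_net (X : set 'rV[R]_d) (e : R) : compact X -> 0 < e ->
  exists s : seq X, forall x : X, exists2 p, p \in s &
    (ball (val p) e)° (val x).
Proof.
rewrite compact_cover => cX e0.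
have [||D _ XD] := cX X setT (fun p => (ball (val p) e)°).
- by move=> i _; exact: open_interior.
- move=> x Xx; exists (exist _ x (mem_set Xx)) => //=.
  exact: nbhsx_ballx.
exists (finmap.enum_fset D) => x; have [p pD xp] := XD (val x) (set_valP x).
by exists p.
Qed.

End EuclideanSpace.

Lemma valL_set_val (T V : Type) (A : set T) (v : V) (f : A -> V) (x : A) :
  valL_ v f (set_val x) = f x.
Proof. by have := congr1 (@^~ x) (valLK v f). Qed.

Lemma valL_out (T V : Type) (A : set T) (v : V) (f : A -> V) x :
  ~ A x -> valL_ v f x = v.
Proof.
by move=> nAx; rewrite /valL_/= oinv_set_val insubN//; apply/negP => /set_mem.
Qed.

Section Caratheodory.
Context (R : realType) (d : nat) (X : set 'rV[R]_d) (cX : compact X).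
Context dO (O : measurableType dO) (psi : O -> X -> R).
Hypothesis mpsi : forall x, measurable_fun setT (psi ^~ x).
Hypothesis psi_lip : forall g, exists C, forall x y : X,
  (psi g x - psi g y) ^+ 2 <= C * dotv (val x - val y) (val x - val y).

Let nearby (e : R) (p : X) (x : 'rV[R]_d) : bool :=
  x \in ((ball (val p) e)° : set 'rV[R]_d).

(** A step function in [x]: only finitely many evaluations of [f] enter, which gives joint
    measurability in [f] and [x]. The default 0 is never reached on [X] when [s] is a net of radius
    [e]. *)
Let near_value e (s : seq X) (f : X -> R) x :=
  foldr (fun p v => if nearby e p x then f p else v) 0 s.

Let near_valueP e s f (x : 'rV[R]_d) : (exists2 p, p \in s & (ball (val p) e)° x) ->
  exists2 p, ball (val p) e x & near_value e s f x = f p.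
Proof.
elim: s => [|p s IH] [q]//=; rewrite inE => qs qx.
case: ifPn => [/set_mem/interior_subset px|npx]; first by exists p.
move: qs => /orP[/eqP qp|qs]; last by apply: IH; exists q.
by move: npx; rewrite /nearby -qp mem_set.
Qed.

Let measurable_near_value e s : measurable_fun setT
  (fun q : O * borel_rV R d => near_value e s (psi q.1) q.2).
Proof.
elim: s => [|p s IH] /=; first exact: measurable_cst.
apply: measurable_fun_ifT => //.
  2: exact: (measurableT_comp (mpsi p) measurable_fst).
apply: (@measurableT_comp _ _ _ _ _ _ (nearby e p : borel_rV R d -> bool)) => //.
apply: (measurable_fun_bool true); rewrite setTI.
have -> : nearby e p @^-1` [set true] = (ball (val p) e)°.
  by apply/seteqP; split => [x /set_mem//|x /mem_set].
by apply: open_borel; exact: open_interior.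
Qed.

(** A function measurable in [g] and Lipschitz in [x] is the limit of its step functions along nets
    of radius tending to 0. The convergence is only pointwise, so the Lipschitz constant may depend
    on [g]. *)
Lemma caratheodory_measurable : measurable_fun setT
  (fun q : O * borel_rV R d => valL_ 0 (psi q.1) q.2).
Proof.
have /choice[s sP] n : exists s : seq X, forall x : X, exists2 p, p \in s &
    (ball (val p) (n.+1%:R^-1 : R))° (val x).
  by apply: compact_net.
pose h n (q : O * borel_rV R d) : R :=
  if q.2 \in X then near_value n.+1%:R^-1 (s n) (psi q.1) q.2 else 0.
apply: (measurable_fun_cvg (h := h)) => [n|[g x] _]; last first.
  suff: h ^~ (g, x) @ \oo --> valL_ 0 (psi g) x by [].
  have [xX|nxX] := boolP (x \in X); last first.
    rewrite valL_out; last by move=> /mem_set; rewrite (negbTE nxX).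
    rewrite (_ : h ^~ _ = cst 0); first exact: cvg_cst.
    by apply/funext => n; rewrite /h/= (negbTE nxX).
  pose y : X := exist _ x xX.
  rewrite -[x]/(set_val y) valL_set_val; have [C hC] := psi_lip g.
  (* The absolute value allows for a negative [C]; adding 1 makes [K] at most its own square. *)
  pose K := `|C| * d%:R + 1; have K1 : 1 <= K by rewrite lerDr mulr_ge0.
  have K0 : 0 < K by exact: lt_le_trans K1.
  apply/cvgrPdist_le => /= e e0.
  have eK0 : 0 < e / K by exact: divr_gt0.
  near=> n; rewrite /h/= xX; have [p xp ->] := @near_valueP _ _ (psi g) _ (sP n y).
  have r0 : 0 <= n.+1%:R^-1 :> R by [].
  have : `|psi g y - psi g p| <= K * n.+1%:R^-1.
    rewrite -ler_sqr ?nnegrE ?mulr_ge0// ?(ltW K0)// real_normK ?num_real//.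
    apply: (le_trans (hC y p)); apply: (@le_trans _ _ (`|C| * (d%:R * n.+1%:R^-1 ^+ 2))).
      apply: (le_trans (ler_wpM2r (dotv_ge0 _) (ler_norm C))).
      by rewrite ler_wpM2l// ball_dotv.
    rewrite mulrA exprMn ler_wpM2r ?sqr_ge0//.
    by rewrite expr2; apply: (@le_trans _ _ K); [rewrite lerDl|rewrite ler_peMl// ltW].
  move/le_trans; apply; rewrite mulrC -ler_pdivlMr// ltW//.
  near: n; exact: (near_infty_natSinv_lt (PosNum eK0)).
apply: measurable_fun_ifT => //.
apply: (@measurableT_comp _ _ _ _ _ _ ((fun x => x \in X) : borel_rV R d -> bool)) => //.
apply: (measurable_fun_bool true); rewrite setTI.
have -> : (fun x => x \in X) @^-1` [set true] = X.
  by apply/seteqP; split => [x /set_mem//|x /mem_set].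
exact: compact_borel.
Unshelve. all: by end_near. Qed.

End Caratheodory.

(** * Random features *)

Section IntegrationComplements.
Context dO (O : measurableType dO) (R : realType) (mu : probability O R).

Lemma ae_sub (P Q : set O) : (forall y, P y -> Q y) ->
  (\forall y \ae mu, P y) -> \forall y \ae mu, Q y.
Proof. by move=> PQ; apply: filterS. Qed.

(** The minimum of [f] and [g] is below [g] everywhere and equals [f] almost everywhere. *)
Lemma ae_ge0_le_integral (f g : O -> R) :
  measurable_fun setT f -> measurable_fun setT g ->
  (forall y, 0 <= f y) -> (forall y, 0 <= g y) -> (\forall y \ae mu, f y <= g y) ->
  (\int[mu]_y (f y)%:E <= \int[mu]_y (g y)%:E)%E.
Proof.
move=> mf mg f0 g0 fg.
have mfg : measurable_fun setT (fun y => Num.min (f y) (g y)).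
  exact: measurable_minr.
have -> : (\int[mu]_y (f y)%:E = \int[mu]_y (Num.min (f y) (g y))%:E)%E.
  apply: ge0_ae_eq_integral => //; try exact/measurable_EFinP.
  - by move=> y _; rewrite lee_fin.
  - by move=> y _; rewrite lee_fin le_min f0 g0.
  - by apply: filterS fg => y fgy _; rewrite min_l.
apply: ge0_le_integral => //; try exact/measurable_EFinP.
- by move=> y _; rewrite lee_fin le_min f0 g0.
- by move=> y _; rewrite lee_fin ge_min lexx orbT.
Qed.

Lemma ae_integral_le_cst (f : O -> R) c :
  measurable_fun setT f -> (forall y, 0 <= f y) -> 0 <= c ->
  (\forall y \ae mu, f y <= c) -> (\int[mu]_y (f y)%:E <= c%:E)%E.
Proof.
move=> mf f0 c0 fc; have := @ae_ge0_le_integral f (cst c) mf (measurable_cst _) f0.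
move=> /(_ (fun=> c0) fc) /le_trans; apply.
by rewrite [leLHS](integral_cst mu measurableT c%:E)/= [mu _]probability_setT mule1.
Qed.

Lemma EFin_Rintegral (f : O -> R) : mu.-integrable setT (EFin \o f) ->
  (\int[mu]_y (f y)%:E = (\int[mu]_(y in setT) f y)%R%:E)%E.
Proof. by move=> fi; rewrite /Rintegral fineK//; exact: integrable_fin_num fi. Qed.

Lemma integrable_wsum n (c : nat -> R) (f : nat -> O -> R) :
  (forall k, mu.-integrable setT (EFin \o f k)) ->
  mu.-integrable setT (EFin \o (fun y => \sum_(k < n) c k * f k y)).
Proof.
move=> fi; rewrite (_ : _ \o _ =
    fun y => (\sum_(k < n) ((c k)%:E * (f k y)%:E))%E); last first.
  by apply/funext => y /=; rewrite -sumEFin; apply: eq_bigr => k _; rewrite EFinM.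
by apply: integrable_sum => // k _; apply: integrableZl => //; exact: fi.
Qed.

Lemma Rintegral_wsum n (c : nat -> R) (f : nat -> O -> R) :
  (forall k, mu.-integrable setT (EFin \o f k)) ->
  \int[mu]_(y in setT) (\sum_(k < n) c k * f k y) =
  \sum_(k < n) c k * \int[mu]_(y in setT) f k y.
Proof.
move=> fi; elim: n => [|n IH].
  rewrite big_ord0; under eq_Rintegral do rewrite big_ord0.
  by rewrite Rintegral_cst// mul0r.
under eq_Rintegral do rewrite big_ord_recr/=.
rewrite RintegralD//; last 2 first.
- exact: (integrable_wsum n c).
- rewrite (_ : _ \o _ = fun y => ((c n)%:E * (f n y)%:E)%E).
    by apply: integrableZl => //; exact: fi.
  by apply/funext => y /=; rewrite EFinM.
by rewrite IH RintegralZl// big_ord_recr.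
Qed.

End IntegrationComplements.

Section Activation.
Context (R : realType) (sigma : R -> R) (J : R).
Hypotheses (hJ : J.-lipschitz sigma) (sigma0 : sigma 0 = 0).

Lemma activation_distr a b : `|sigma a - sigma b| <= J * `|a - b|.
Proof. exact: (hJ (x := (a, b))). Qed.

Lemma activation_dist_sqr a b : (sigma a - sigma b) ^+ 2 <= J ^+ 2 * (a - b) ^+ 2.
Proof.
rewrite -[leLHS]real_normK ?num_real// -[in leRHS](real_normK (num_real (a - b))).
rewrite -exprMn ler_sqr ?nnegrE//; first exact: activation_distr.
exact: le_trans (activation_distr a b).
Qed.

Lemma activation_sqr a : sigma a ^+ 2 <= J ^+ 2 * a ^+ 2.
Proof. by have := activation_dist_sqr a 0; rewrite sigma0 !subr0. Qed.

Lemma measurable_activation : measurable_fun setT sigma.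
Proof.
apply: continuous_measurable_fun => a; apply/cvgrPdist_le => /= e e0.
pose K := `|J| + 1; have K0 : 0 < K by rewrite ltr_wpDl.
have eK0 : 0 < e / K by exact: divr_gt0.
have near_a : \forall b \near a, `|a - b| <= e / K.
  by have /cvgrPdist_le := @cvg_id _ (nbhs a); apply.
apply: filterS near_a => b ab; apply: (le_trans (activation_distr a b)).
apply: (@le_trans _ _ (K * `|a - b|)).
  by rewrite ler_wpM2r// (le_trans (ler_norm _))// lerDl.
by rewrite mulrC -ler_pdivlMr.
Qed.

End Activation.

(** * Kernels of random features: regularity and integral representation *)

Section Features.
Context (R : realType) (d : nat) (X : set 'rV[R]_d) (sigma : R -> R) (J : R).
Hypotheses (hJ : J.-lipschitz sigma) (sigma0 : sigma 0 = 0).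

(** A single constant controls growth and Lipschitz continuity, homogeneously in the squared norm.
    From one layer to the next it is multiplied by [J ^+ 2 * D ^+ 2], see [regular_next]. *)
Definition regular_rkhs (H : rkhs R X) (G : R) := forall h, carrier H h ->
  forall x y : X, h x ^+ 2 <= G * ip H h h * dotv (val x) (val x) /\
  (h x - h y) ^+ 2 <= G * ip H h h * dotv (val x - val y) (val x - val y).

Lemma regular_linear (H : rkhs R X) : is_linear_rkhs H -> regular_rkhs H 1.
Proof.
move=> [_ HK] h Hh x y; rewrite mul1r; split; first exact: eval_le HK Hh.
by rewrite dotv_sub; exact: eval_dist_le HK Hh.
Qed.

Lemma rkhs_elt_carrier (H : rkhs R X) (g : rkhs_space H) : carrier H (sval g).
Proof. exact: set_mem (svalP g). Qed.

Lemma measurable_eval (H : rkhs R X) x :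
  measurable_fun setT (fun g : rkhs_space H => sval g x).
Proof.
move=> _ B mB; rewrite setTI; apply: sub_gen_smallest.
by exists x => //; exists B => //; rewrite setTI.
Qed.

Context (H : rkhs R X) (mu : probability (rkhs_space H) R) (D G : R).
Hypothesis fin : kappa_finite sigma mu.
Hypothesis D0 : 0 <= D.
Hypothesis aeD : \forall g \ae mu, rkhs_norm H (sval g) <= D.
Hypothesis regH : regular_rkhs H G.
Hypothesis G0 : 0 <= G.

Local Notation K := (kappa sigma mu).
Local Notation S x := (fun g : rkhs_space H => sigma (sval g x)).

Let mS x : measurable_fun setT (S x).
Proof.
apply: (measurableT_comp (measurable_activation hJ)); exact: measurable_eval.
Qed.

Let iSS x y : mu.-integrable setT (EFin \o (fun g => S x g * S y g)).
Proof. exact: fin. Qed.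

Lemma next_ge0 : 0 <= J ^+ 2 * D ^+ 2 * G.
Proof. by rewrite mulr_ge0// mulr_ge0// sqr_ge0. Qed.

Lemma ae_ip_le : \forall g \ae mu, ip H (sval g) (sval g) <= D ^+ 2.
Proof.
apply: ae_sub aeD => g gD; rewrite -rkhs_normE; last exact: rkhs_elt_carrier.
by rewrite ler_sqr ?nnegrE// sqrtr_ge0.
Qed.

Lemma kappa_diag_le x : K x x <= J ^+ 2 * D ^+ 2 * G * dotv (val x) (val x).
Proof.
rewrite -lee_fin /kappa -EFin_Rintegral; last exact: iSS.
apply: ae_integral_le_cst.
- exact: measurable_funM.
- by move=> g; rewrite -expr2 sqr_ge0.
- by rewrite mulr_ge0 ?dotv_ge0// next_ge0.
apply: ae_sub ae_ip_le => g gD; rewrite -expr2.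
apply: (le_trans (activation_sqr hJ sigma0 _)); rewrite -2![leRHS]mulrA ler_wpM2l ?sqr_ge0//.
have [+ _] := regH (rkhs_elt_carrier g) x x.
move/le_trans; apply; rewrite mulrA [_ * G]mulrC.
by rewrite ler_wpM2r ?dotv_ge0// ler_wpM2l.
Qed.

(** The left side is the second moment of [S x - S y] under [mu], to which the Lipschitz bounds of
    [sigma] and of almost every [g] apply. *)
Lemma kappa_dist_le x y : K x x - K x y - K y x + K y y <=
  J ^+ 2 * D ^+ 2 * G * dotv (val x - val y) (val x - val y).
Proof.
have iB a b c e : mu.-integrable setT
    (EFin \o (fun g => S a g * S b g - S c g * S e g)).
  exact: (integrableB measurableT (iSS a b) (iSS c e)).
have -> : K x x - K x y - K y x + K y y =
    \int[mu]_(g in setT) ((S x g - S y g) ^+ 2).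
  rewrite /kappa -addrA [- _ + _]addrC -!RintegralB// -RintegralD//.
  by apply: eq_Rintegral => g _; ring.
rewrite -lee_fin -EFin_Rintegral; last first.
  rewrite (_ : _ \o _ = fun g => ((S x g * S x g - S x g * S y g)%:E +
      (S y g * S y g - S y g * S x g)%:E)%E).
    exact: (integrableD measurableT (iB x x x y) (iB y y y x)).
  by apply/funext => g; rewrite /= -EFinD; congr (_%:E); ring.
apply: ae_integral_le_cst.
- by apply: measurable_funX; exact: measurable_funB.
- by move=> g; rewrite sqr_ge0.
- by rewrite mulr_ge0 ?dotv_ge0// next_ge0.
apply: ae_sub ae_ip_le => g gD.
apply: (le_trans (activation_dist_sqr hJ _ _)); rewrite -2![leRHS]mulrA ler_wpM2l ?sqr_ge0//.
have [_ +] := regH (rkhs_elt_carrier g) x y.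
move/le_trans; apply; rewrite mulrA [_ * G]mulrC.
by rewrite ler_wpM2r ?dotv_ge0// ler_wpM2l.
Qed.

Context (H' : rkhs R X).
Hypothesis HK : has_kernel H' K.

Lemma regular_next : regular_rkhs H' (J ^+ 2 * D ^+ 2 * G).
Proof.
move=> h Hh x y; rewrite [_ * ip _ _ _]mulrC; split; rewrite -[leRHS]mulrA.
  apply: (le_trans (eval_le _ HK Hh)); rewrite ler_wpM2l ?ip_ge0//.
  exact: kappa_diag_le.
apply: (le_trans (eval_dist_le _ _ HK Hh)); rewrite ler_wpM2l ?ip_ge0//.
exact: kappa_dist_le.
Qed.

(** The density which represents a finite combination of kernel sections as an integral of features,
    see [integral_feature]. *)
Definition feature_coef n (c : nat -> R) (p : nat -> X) (g : rkhs_space H) :=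
  \sum_(k < n) c k * sigma (sval g (p k)).

Definition feature_sum n (c : nat -> R) (p : nat -> X) : X -> R :=
  \sum_(k < n) c k *: K ^~ (p k).

Lemma measurable_feature_coef n c p : measurable_fun setT (feature_coef n c p).
Proof. by apply: measurable_sum => k; exact: measurable_funM. Qed.

Lemma integrable_feature n c p x :
  mu.-integrable setT (EFin \o (fun g => feature_coef n c p g * S x g)).
Proof.
rewrite (_ : _ \o _ = EFin \o (fun g => \sum_(k < n) c k * (S x g * S (p k) g))).
  exact: (integrable_wsum n c (fun k => iSS x (p k))).
apply/funext => g /=; rewrite /feature_coef mulr_suml; congr (_%:E).
by apply: eq_bigr => k _; ring.
Qed.

Lemma integral_feature n c p x :
  \int[mu]_(g in setT) (feature_coef n c p g * S x g) = feature_sum n c p x.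
Proof.
transitivity (\int[mu]_(g in setT) \sum_(k < n) c k * (S x g * S (p k) g)).
  apply: eq_Rintegral => g _; rewrite /feature_coef mulr_suml.
  by apply: eq_bigr => k _; ring.
by rewrite (Rintegral_wsum n c (fun k => iSS x (p k))) /feature_sum
  (@eval_sum _ _ n c (fun k => K ^~ (p k))).
Qed.

Lemma integrable_feature_sqr n c p :
  mu.-integrable setT (EFin \o (fun g => feature_coef n c p g ^+ 2)).
Proof.
rewrite (_ : _ \o _ = EFin \o
    (fun g => \sum_(k < n) c k * (feature_coef n c p g * S (p k) g))).
  exact: (integrable_wsum n c (fun k => integrable_feature n c p (p k))).
apply/funext => g /=; rewrite expr2 {2}/feature_coef mulr_sumr; congr (_%:E).
by apply: eq_bigr => k _; ring.
Qed.

Lemma carrier_feature_sum n c p : carrier H' (feature_sum n c p).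
Proof.
apply: (@carrier_sum _ _ _ n c (fun k => K ^~ (p k))) => k.
by have [] := HK (p k).
Qed.

(** An isometry from L2([mu]) to [H']: expanding one of the two factors leaves values of
    [feature_sum] at the points [p k], which the reproducing property turns into inner products. *)
Lemma integral_feature_sqr n c p :
  \int[mu]_(g in setT) (feature_coef n c p g ^+ 2) =
  ip H' (feature_sum n c p) (feature_sum n c p).
Proof.
have Hs := carrier_feature_sum n c p.
rewrite {1}/feature_sum (@ip_suml _ _ _ n c (fun k => K ^~ (p k)))//; last first.
  by move=> k; have [] := HK (p k).
transitivity (\int[mu]_(g in setT)
    \sum_(k < n) c k * (feature_coef n c p g * S (p k) g)).
  apply: eq_Rintegral => g _; rewrite expr2 {2}/feature_coef mulr_sumr.
  by apply: eq_bigr => k _; ring.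
rewrite (Rintegral_wsum n c (fun k => integrable_feature n c p (p k))).
apply: eq_bigr => k _; rewrite integral_feature.
have [Hk ek] := HK (p k); by rewrite ip_sym// ek.
Qed.

(** A function and its interpolant agree on a fine net and obey the same Lipschitz bound. The net
    does not depend on [h], so the same points serve for all the units of a layer. *)
Lemma feature_approximation (x0 : X) (eta : R) : compact X -> 0 < eta ->
  exists n (p : nat -> X), forall h, carrier H' h -> exists c,
    ip H' (feature_sum n c p) (feature_sum n c p) <= ip H' h h /\
    forall x, (feature_sum n c p x - h x) ^+ 2 <= eta * ip H' h h.
Proof.
move=> cX eta0.
pose G' := J ^+ 2 * D ^+ 2 * G; have G'0 : 0 <= G' := next_ge0.
(* As [e ^+ 2 = eta / A], the final bound [4 * G' * d * e ^+ 2] is at most [eta]; the 1 keeps [A]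
   positive. *)
pose A := 4 * G' * d%:R + 1.
have A0 : 0 < A by rewrite ltr_wpDl// mulr_ge0// mulr_ge0.
pose e := Num.sqrt (eta / A); have e0 : 0 < e by rewrite sqrtr_gt0 divr_gt0.
have [s sP] := compact_net cX e0.
exists (size s), (nth x0 s) => h Hh.
have [c [Hf fh ff]] := interpolation (nth x0 s) (size s) HK Hh.
exists c; split => // x; rewrite -/(feature_sum _ _ _) in Hf fh ff.
have [p ps /interior_subset px] := sP x.
have fp : feature_sum (size s) c (nth x0 s) p = h p.
  by have := fh (index p s); rewrite index_mem nth_index// => ->.
set f := feature_sum _ _ _ in Hf fh ff fp *.
have [_ h1] := regular_next Hh x p; have [_ f1] := regular_next Hf x p.
rewrite -/G' in h1 f1.
have bd : dotv (val x - val p) (val x - val p) <= d%:R * (eta / A).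
  apply: (le_trans (ball_dotv px)); rewrite sqr_sqrtr//.
  by rewrite divr_ge0// ltW.
have hh := ip_ge0 Hh.
have f2 : (f x - f p) ^+ 2 <= G' * ip H' h h * dotv (val x - val p) (val x - val p).
  by apply: (le_trans f1); rewrite ler_wpM2r ?dotv_ge0// ler_wpM2l.
have -> : f x - h x = (f x - f p) - (h x - h p) by rewrite fp; ring.
have sq (a b : R) : (a - b) ^+ 2 <= 2 * a ^+ 2 + 2 * b ^+ 2.
  by have := sqr_ge0 (a + b); nra.
apply: (le_trans (sq _ _)).
apply: (@le_trans _ _ (4 * (G' * ip H' h h * (d%:R * (eta / A))))).
  apply: (@le_trans _ _ (4 * (G' * ip H' h h * dotv (val x - val p) (val x - val p)))).
    by move: h1 f2; set q := G' * _ * _; lra.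
  by rewrite ler_wpM2l// ler_wpM2l// mulr_ge0.
rewrite (_ : 4 * _ = (4 * G' * d%:R) / A * (eta * ip H' h h)); last by field; lra.
rewrite ler_piMl//; first by rewrite mulr_ge0// ltW.
by rewrite ler_pdivrMr// mul1r lerDl.
Qed.

End Features.

(** A single function is a family constant in [g], so joint measurability applies. *)
Lemma measurable_regular (R : realType) d (X : set 'rV[R]_d) (H : rkhs R X) G h :
  compact X -> regular_rkhs H G -> carrier H h ->
  measurable_fun setT (fun x : borel_rV R d => valL_ 0 h x).
Proof.
move=> cX regH Hh.
have := @caratheodory_measurable _ _ _ cX _ (rkhs_space H) (fun=> h) _ _.
move=> /(_ (fun=> measurable_cst _)) mm.
have /mm {}mm : forall g : rkhs_space H, exists C, forall x y : X,
    (h x - h y) ^+ 2 <= C * dotv (val x - val y) (val x - val y).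
  by move=> _; exists (G * ip H h h) => x y; have [] := regH _ Hh x y.
have g0 : rkhs_space H := exist _ 0 (mem_set (rkhs0 H)).
exact: (measurableT_comp mm (pair1_measurable g0)).
Qed.

(** * Deterministic sampling of one layer *)

Section LayerSampling.
Context (R : realType) (d : nat) (X : set 'rV[R]_d) (cX : compact X).
Context (sigma : R -> R) (J : R).
Hypotheses (hJ : J.-lipschitz sigma) (sigma0 : sigma 0 = 0).
Context (nu : probability (borel_rV R d) R) (M : R).
Hypothesis hM : (\int[nu]_x (dotv x x)%:E = M%:E)%E.
Context (H H' : rkhs R X) (mu : probability (rkhs_space H) R) (D G : R).
Hypothesis fin : kappa_finite sigma mu.
Hypothesis D0 : 0 <= D.
Hypothesis aeD : \forall g \ae mu, rkhs_norm H (sval g) <= D.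
Hypothesis regH : regular_rkhs H G.
Hypothesis G0 : 0 <= G.
Hypothesis HK : has_kernel H' (kappa sigma mu).

Local Notation G' := (J ^+ 2 * D ^+ 2 * G).
Local Notation ev g x := (valL_ 0 (sval g : X -> R) x).

Variables (m n : nat) (w : 'I_m -> R) (c : 'I_m -> nat -> R) (p : nat -> X).
Variable (gamma : R).
Hypothesis w0 : forall i, 0 <= w i.
Hypothesis gamma0 : 0 <= gamma.

Local Notation a i := (fun g : rkhs_space H => feature_coef sigma n (c i) p g).
Local Notation f i := (feature_sum sigma mu n (c i) p).
Let B := \sum_i w i * ip H' (f i) (f i).

Let ma i : measurable_fun setT (a i).
Proof. exact: measurable_feature_coef hJ _ _ _ _. Qed.

Let mev : measurable_fun setT
  (fun q : rkhs_space H * borel_rV R d => ev q.1 q.2).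
Proof.
apply: (@caratheodory_measurable _ _ _ cX _ _ (fun g : rkhs_space H => sval g)).
- by move=> x; exact: measurable_eval.
- move=> g; exists (G * ip H (sval g) (sval g)) => x y.
  by have [] := regH (rkhs_elt_carrier g) x y.
Qed.

Let mev1 x : measurable_fun setT (fun g : rkhs_space H => ev g x).
Proof. exact: (measurableT_comp mev (pair2_measurable (x : borel_rV R d))). Qed.

Let msev x : measurable_fun setT (fun g : rkhs_space H => sigma (ev g x)).
Proof. exact: (measurableT_comp (measurable_activation hJ) (mev1 x)). Qed.

Let mau i x : measurable_fun setT (fun g => (a i g * sigma (ev g x)) ^+ 2).
Proof. by apply: measurable_funX; apply: measurable_funM => //; exact: msev. Qed.

Let in_X (P : 'rV[R]_d -> Prop) : (forall y : X, P (set_val y)) ->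
  (forall y, ~ X y -> P y) -> forall x, P x.
Proof.
move=> PX PnX x; have [xX|/negP nxX] := boolP (x \in X).
  exact: (PX (exist _ x xX)).
by apply: PnX => /mem_set.
Qed.

Lemma activation_eval_le (g : rkhs_space H) x : ip H (sval g) (sval g) <= D ^+ 2 ->
  sigma (ev g x) ^+ 2 <= G' * dotv x x.
Proof.
(* Outside [X] functions are extended by 0, and the bound holds there because [sigma 0 = 0]. *)
move=> gD; elim/in_X: x => [y|x nXx]; last first.
  rewrite valL_out// sigma0 expr0n/= mulr_ge0 ?dotv_ge0//; exact: next_ge0.
rewrite valL_set_val; apply: (le_trans (activation_sqr hJ sigma0 _)).
rewrite -2![leRHS]mulrA ler_wpM2l ?sqr_ge0//.
have [+ _] := regH (rkhs_elt_carrier g) y y.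
move/le_trans; apply; rewrite mulrA [_ * G]mulrC.
by rewrite ler_wpM2r ?dotv_ge0// ler_wpM2l.
Qed.

Let ae_activation i x : \forall g \ae mu,
  (a i g * sigma (ev g x)) ^+ 2 <= G' * dotv x x * a i g ^+ 2.
Proof.
apply: ae_sub (ae_ip_le D0 aeD) => g gD.
by rewrite exprMn mulrC ler_wpM2r ?sqr_ge0// activation_eval_le.
Qed.

Let int_a2 i : (\int[mu]_g (a i g ^+ 2)%:E = (ip H' (f i) (f i))%:E)%E.
Proof.
rewrite EFin_Rintegral; first by rewrite (integral_feature_sqr fin HK).
exact: integrable_feature_sqr.
Qed.

Let int_bound i x :
  (\int[mu]_g ((a i g * sigma (ev g x)) ^+ 2)%:E <=
   (G' * dotv x x * ip H' (f i) (f i))%:E)%E.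
Proof.
have C0 : 0 <= G' * dotv x x by rewrite mulr_ge0 ?dotv_ge0//; exact: next_ge0.
have ma2 : measurable_fun setT (fun g => a i g ^+ 2) by exact: measurable_funX.
apply: (le_trans (ae_ge0_le_integral _ _ _ _ (ae_activation i x))) => //.
- by apply: measurable_funM.
- by move=> g; rewrite sqr_ge0.
- by move=> g; rewrite mulr_ge0 ?sqr_ge0.
under eq_integral do rewrite EFinM.
rewrite ge0_integralZl_EFin//; last 2 first.
- by move=> g _; rewrite lee_fin sqr_ge0.
- exact/measurable_EFinP.
by rewrite int_a2 -EFinM.
Qed.

(** Greedy sampling of the features [a i g * sigma (g x)], whose mean is [f i]. The same functions
    [g j] serve for all [i], and [gamma] prices the squared coefficients. The second moments are
    bounded by [G' * M * B], the mean penalty by [gamma * B], and the almost sure property that is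
    kept is the norm bound. *)
Lemma layer_sampling : exists g : nat -> rkhs_space H,
  (forall j, ip H (sval (g j)) (sval (g j)) <= D ^+ 2) /\
  (\int[nu]_x (\sum_i w i * (\sum_(j < m)
      (a i (g j) * sigma (ev (g j) x) - valL_ 0 (f i) x)) ^+ 2)%:E +
   (\sum_(j < m) gamma * \sum_i w i * a i (g j) ^+ 2)%:E +
   m%:R%:E * \int[nu]_x (\sum_i w i * valL_ 0 (f i) x ^+ 2)%:E <=
   (m%:R * ((G' * M + gamma) * B))%:E)%E.
Proof.
have mf i : measurable_fun setT (fun x : borel_rV R d => valL_ 0 (f i) x).
  apply: (measurable_regular cX (regular_next hJ sigma0 fin D0 aeD regH G0 HK)).
  exact: carrier_feature_sum.
have iu i x : mu.-integrable setT (EFin \o (fun g => a i g * sigma (ev g x))).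
  elim/in_X: x => [y|x nXx].
    under eq_fun do rewrite valL_set_val; exact: integrable_feature.
  under eq_fun do rewrite valL_out// sigma0 mulr0; exact: integrable0.
have iu2 i x : mu.-integrable setT (EFin \o (fun g => (a i g * sigma (ev g x)) ^+ 2)).
  apply/integrableP; split; first by apply/measurable_EFinP; exact: mau.
  under eq_integral do rewrite /= ger0_norm ?sqr_ge0//.
  exact: le_lt_trans (int_bound i x) (ltry _).
have ut i x : (\int[mu]_g (a i g * sigma (ev g x))%:E = (valL_ 0 (f i) x)%:E)%E.
  elim/in_X: x => [y|x nXx].
    under eq_integral do rewrite valL_set_val; rewrite valL_set_val.
    rewrite EFin_Rintegral; last exact: integrable_feature.
    by rewrite integral_feature.
  under eq_integral do rewrite valL_out// sigma0 mulr0.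
  by rewrite integral0 valL_out.
have mu_u i : measurable_fun setT
    (fun q : rkhs_space H * borel_rV R d => a i q.1 * sigma (ev q.1 q.2)).
  apply: measurable_funM; first exact: (measurableT_comp (ma i) measurable_fst).
  exact: (measurableT_comp (measurable_activation hJ) mev).
have mav : measurable_fun setT (fun g => \sum_i w i * a i g ^+ 2).
  apply: measurable_sum => i; apply: measurable_funM => //.
  exact: measurable_funX.
have B0 : 0 <= B.
  apply: sumr_ge0 => i _; rewrite mulr_ge0// ip_ge0//.
  exact: carrier_feature_sum HK n (c i) p.
have leU : (\int[nu]_x \int[mu]_g
    (\sum_i w i * (a i g * sigma (ev g x)) ^+ 2)%:E <= (G' * M * B)%:E)%E.
  have -> : (G' * M * B)%:E = (\int[nu]_x ((G' * B)%:E * (dotv x x)%:E))%E.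
    rewrite ge0_integralZl_EFin//.
    - by rewrite hM -EFinM mulrAC.
    - by move=> x _; rewrite lee_fin dotv_ge0.
    - by apply/measurable_EFinP; exact: measurable_dotvv.
    - by rewrite mulr_ge0//; exact: next_ge0.
  apply: ge0_le_integral => //.
  - move=> x _; apply: integral_ge0 => g _; rewrite lee_fin.
    by apply: sumr_ge0 => i _; rewrite mulr_ge0 ?sqr_ge0.
  - apply: (@measurable_fun_fubini_tonelli_G _ _ _ _ _ mu
      (fun q : rkhs_space H * borel_rV R d =>
        (\sum_i w i * (a i q.1 * sigma (ev q.1 q.2)) ^+ 2)%:E)) => //.
      apply/measurable_EFinP; apply: measurable_sum => i.
      by apply: measurable_funM => //; apply: measurable_funX; exact: mu_u.
    move=> q; rewrite lee_fin; apply: sumr_ge0 => i _.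
    by rewrite mulr_ge0 ?sqr_ge0.
  - apply/measurable_EFinP; apply: measurable_funM => //.
    exact: measurable_dotvv.
  move=> x _; rewrite integral_wsum//; last by move=> i y _; rewrite sqr_ge0.
  apply: (@le_trans _ _ (\sum_i (w i)%:E * (G' * dotv x x * ip H' (f i) (f i))%:E)%E).
    by apply: lee_sum => i _; rewrite lee_wpmul2l ?lee_fin//; exact: int_bound.
  under eq_bigr do rewrite -EFinM.
  rewrite sumEFin -EFinM lee_fin /B mulr_sumr mulr_suml ler_sum// => i _.
  by rewrite le_eqVlt; apply/orP; left; apply/eqP; ring.
have leV : (\int[mu]_g (gamma * \sum_i w i * a i g ^+ 2)%:E <= (gamma * B)%:E)%E.
  under eq_integral do rewrite EFinM.
  rewrite ge0_integralZl_EFin//; last 2 first.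
  - move=> g _; rewrite lee_fin; apply: sumr_ge0 => i _.
    by rewrite mulr_ge0 ?sqr_ge0.
  - by apply/measurable_EFinP; exact: mav.
  rewrite integral_wsum//; last 2 first.
  - by move=> i; exact: measurable_funX.
  - by move=> i y _; rewrite sqr_ge0.
  rewrite EFinM lee_wpmul2l ?lee_fin// /B -sumEFin; apply: lee_sum => i _.
  by rewrite int_a2 -EFinM.
have [||g [Pg Hg]] := greedy_sampling w0 mu_u mf iu iu2 ut
  (v := fun g => gamma * \sum_i w i * a i g ^+ 2) _ _ (ae_ip_le D0 aeD) leU leV m.
- by apply: measurable_funM => //; exact: mav.
- move=> g; rewrite mulr_ge0//; apply: sumr_ge0 => i _.
  by rewrite mulr_ge0 ?sqr_ge0.
exists g; split => //; rewrite mulrDl; exact: Hg.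
Qed.

End LayerSampling.

(** * One layer of a network *)

Section Inequalities.
Context (R : realType).

Lemma sqrD_le (t a b : R) : 0 < t ->
  (a + b) ^+ 2 <= (1 + t) * a ^+ 2 + (1 + t^-1) * b ^+ 2.
Proof.
move=> t0; rewrite -subr_ge0.
have -> : (1 + t) * a ^+ 2 + (1 + t^-1) * b ^+ 2 - (a + b) ^+ 2 =
    (t * a - b) ^+ 2 / t by field; lra.
by rewrite divr_ge0 ?sqr_ge0// ltW.
Qed.

Lemma sqr_mean_le m (c : 'I_m -> R) : (0 < m)%N ->
  (m%:R^-1 * \sum_j c j) ^+ 2 <= m%:R^-1 * \sum_j c j ^+ 2.
Proof.
move=> m0; have mR : 0 < m%:R :> R by rewrite ltr0n.
set A := m%:R^-1 * \sum_j c j.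
have S : \sum_j c j = m%:R * A by rewrite /A mulVKf// gt_eqF.
have : 0 <= \sum_j (c j - A) ^+ 2 by apply: sumr_ge0 => j _; rewrite sqr_ge0.
have -> : \sum_j (c j - A) ^+ 2 =
    \sum_j c j ^+ 2 - 2 * A * \sum_j c j + \sum_(j < m) A ^+ 2.
  by rewrite mulr_sumr -sumrB -big_split/=; apply: eq_bigr => j _; ring.
rewrite sumr_const card_ord -mulr_natl S => h.
rewrite ler_pdivlMl//; move: h; set Q := \sum_j _; nra.
Qed.

(** Here [v] stands for the sampled functions and [u] for the pre-activations that approximate them.
    The error splits into the sampling error and the inherited one, in which unit [j] gets as weight
    the mean of its squared coefficients. *)
Lemma perturbed_layer_le m (w : 'I_m -> R) (a : 'I_m -> 'I_m -> R)
    (sigma : R -> R) (J t : R) (u v : 'I_m -> R) (b : 'I_m -> R) :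
  J.-lipschitz sigma -> (0 < m)%N -> 0 < t -> (forall i, 0 <= w i) ->
  \sum_i w i * (m%:R^-1 * (\sum_j a i j * sigma (u j)) - b i) ^+ 2 <=
  (1 + t) * m%:R^-1 ^+ 2 *
    \sum_i w i * (\sum_j (a i j * sigma (v j) - b i)) ^+ 2 +
  (1 + t^-1) * J ^+ 2 *
    \sum_j (m%:R^-1 * \sum_i w i * a i j ^+ 2) * (u j - v j) ^+ 2.
Proof.
move=> hJ m0 t0 w0; have mR : 0 < m%:R :> R by rewrite ltr0n.
have -> : \sum_j (m%:R^-1 * \sum_i w i * a i j ^+ 2) * (u j - v j) ^+ 2 =
    \sum_i w i * (m%:R^-1 * \sum_j a i j ^+ 2 * (u j - v j) ^+ 2).
  transitivity (\sum_j \sum_i w i * (m%:R^-1 * (a i j ^+ 2 * (u j - v j) ^+ 2))).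
    apply: eq_bigr => j _; rewrite mulr_sumr mulr_suml.
    by apply: eq_bigr => i _; ring.
  rewrite exchange_big/=; apply: eq_bigr => i _.
  by rewrite !mulr_sumr.
rewrite [X in _ <= X + _]mulr_sumr [X in _ <= _ + X]mulr_sumr -big_split/=.
apply: ler_sum => i _; have -> : m%:R^-1 * (\sum_j a i j * sigma (u j)) - b i =
    m%:R^-1 * (\sum_j (a i j * sigma (v j) - b i)) +
    m%:R^-1 * \sum_j a i j * (sigma (u j) - sigma (v j)).
  rewrite -mulrDr -big_split/=.
  have -> : \sum_j (a i j * sigma (v j) - b i +
      a i j * (sigma (u j) - sigma (v j))) =
      (\sum_j a i j * sigma (u j)) - m%:R * b i.
    rewrite mulr_natl -[X in _ *+ X](card_ord m) -sumr_const -sumrB.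
    by apply: eq_bigr => j _; ring.
  by rewrite mulrBr mulKf// gt_eqF.
have t1 : 0 <= 1 + t^-1 by rewrite addr_ge0// invr_ge0 ltW.
rewrite [(1 + t) * _ * _]mulrCA [(1 + t^-1) * _ * _]mulrCA
  -[leRHS]mulrDr ler_wpM2l//.
apply: (le_trans (sqrD_le _ _ t0)); rewrite exprMn mulrA lerD2l.
rewrite -[leRHS]mulrA ler_wpM2l//; apply: (le_trans (sqr_mean_le _ m0)).
rewrite [leRHS]mulrCA ler_wpM2l ?invr_ge0//.
rewrite mulr_sumr ler_sum// => j _; rewrite exprMn [leRHS]mulrCA ler_wpM2l ?sqr_ge0//.
exact: activation_dist_sqr.
Qed.

(** Passes from the interpolants [b], which have an exact feature representation, to the functions
    [h] to be approximated, in the error and in the variance term alike. *)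
Lemma change_target_le m (w a b h : 'I_m -> R) (s c : R) : 0 < s -> 0 <= c ->
  (forall i, 0 <= w i) ->
  \sum_i w i * ((a i - h i) ^+ 2 + c * h i ^+ 2) <=
  (1 + s) * (\sum_i w i * (a i - b i) ^+ 2 + c * \sum_i w i * b i ^+ 2) +
  (1 + s^-1) * (1 + c) * \sum_i w i * (b i - h i) ^+ 2.
Proof.
move=> s0 c0 w0; rewrite [c * _]mulr_sumr -big_split/= !mulr_sumr -big_split/=.
apply: ler_sum => i _.
have -> : (1 + s) * (w i * (a i - b i) ^+ 2 + c * (w i * b i ^+ 2)) +
    (1 + s^-1) * (1 + c) * (w i * (b i - h i) ^+ 2) =
  w i * (((1 + s) * (a i - b i) ^+ 2 + (1 + s^-1) * (b i - h i) ^+ 2) +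
   c * ((1 + s) * b i ^+ 2 + (1 + s^-1) * (- (b i - h i)) ^+ 2)) by ring.
rewrite ler_wpM2l// lerD//.
  by have := sqrD_le (a i - b i) (b i - h i) s0; rewrite subrKA.
rewrite ler_wpM2l//.
by have := sqrD_le (b i) (- (b i - h i)) s0; rewrite opprB addrC subrK.
Qed.

End Inequalities.

Lemma preact_eq (R : realType) d m (sigma : R -> R) (z : 'I_m -> 'rV[R]_d) W W' k :
  (forall l, (l <= k)%N -> W l = W' l) ->
  preact sigma z W k = preact sigma z W' k.
Proof.
elim: k => [//|k IH] WW'; apply/funext => i; apply/funext => x /=.
rewrite WW'// IH// => l lk; exact/WW'/leqW.
Qed.

Lemma measurable_preact (R : realType) d m (sigma : R -> R) J
    (z : 'I_m -> 'rV[R]_d) W k i : J.-lipschitz sigma ->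
  measurable_fun setT (fun x : borel_rV R d => preact sigma z W k i x).
Proof.
move=> hJ; elim: k i => [|k IH] i /=; first exact: measurable_dotv.
apply: measurable_funM => //; apply: measurable_sum => j.
apply: measurable_funM => //.
exact: (measurableT_comp (measurable_activation hJ) (IH j)).
Qed.

Lemma integral_lin3_le dO (O : measurableType dO) (R : realType)
    (nu : probability O R) (D : set O) (f1 f2 f3 : O -> R)
    (a1 a2 a3 k I1 I2 I3 : R) : measurable D ->
  measurable_fun D f1 -> measurable_fun D f2 -> measurable_fun D f3 ->
  (forall x, 0 <= f1 x) -> (forall x, 0 <= f2 x) -> (forall x, 0 <= f3 x) ->
  0 <= a1 -> 0 <= a2 -> 0 <= a3 -> 0 <= k ->
  (\int[nu]_(x in D) (f1 x)%:E <= I1%:E)%E ->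
  (\int[nu]_(x in D) (f2 x)%:E <= I2%:E)%E ->
  (\int[nu]_(x in D) (f3 x)%:E <= I3%:E)%E ->
  (\int[nu]_(x in D) (a1 * f1 x + a2 * f2 x + a3 * f3 x + k)%:E <=
   (a1 * I1 + a2 * I2 + a3 * I3 + k)%:E)%E.
Proof.
move=> mD m1 m2 m3 f10 f20 f30 a10 a20 a30 k0 h1 h2 h3.
have Z (a : R) (f : O -> R) (I : R) : 0 <= a -> measurable_fun D f -> (forall x, 0 <= f x) ->
    (\int[nu]_(x in D) (f x)%:E <= I%:E ->
     \int[nu]_(x in D) (a * f x)%:E <= (a * I)%:E)%E.
  move=> a0 mf f0 fI; under eq_integral do rewrite EFinM.
  rewrite ge0_integralZl_EFin//; last 2 first.
  - by move=> x _; rewrite lee_fin.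
  - exact/measurable_EFinP.
  by rewrite EFinM lee_wpmul2l ?lee_fin.
have A (f g : O -> R) (I I' : R) : measurable_fun D f -> measurable_fun D g ->
    (forall x, 0 <= f x) -> (forall x, 0 <= g x) ->
    (\int[nu]_(x in D) (f x)%:E <= I%:E -> \int[nu]_(x in D) (g x)%:E <= I'%:E ->
     \int[nu]_(x in D) (f x + g x)%:E <= (I + I')%:E)%E.
  move=> mf mg f0 g0 fI gI; under eq_integral do rewrite EFinD.
  rewrite ge0_integralD//; last 4 first.
  - by move=> x _; rewrite lee_fin.
  - exact/measurable_EFinP.
  - by move=> x _; rewrite lee_fin.
  - exact/measurable_EFinP.
  by rewrite EFinD leeD.
have mZ (a : R) (f : O -> R) : measurable_fun D f -> measurable_fun D (fun x => a * f x).
  by move=> mf; exact: measurable_funM.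
have Z0 (a : R) (f : O -> R) : 0 <= a -> (forall x, 0 <= f x) -> forall x, 0 <= a * f x.
  by move=> a0 f0 x; exact: mulr_ge0.
have D0 (f g : O -> R) : (forall x, 0 <= f x) -> (forall x, 0 <= g x) ->
    forall x, 0 <= f x + g x by move=> f0 g0 x; exact: addr_ge0.
have mA (f g : O -> R) : measurable_fun D f -> measurable_fun D g ->
    measurable_fun D (fun x => f x + g x) by move=> mf mg; exact: measurable_funD.
have p1 := Z0 _ _ a10 f10; have p2 := Z0 _ _ a20 f20; have p3 := Z0 _ _ a30 f30.
have n1 := mZ a1 _ m1; have n2 := mZ a2 _ m2; have n3 := mZ a3 _ m3.
have p12 := D0 _ _ p1 p2; have n12 := mA _ _ n1 n2.
apply: (A _ (cst k)) => //.
- exact: mA.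
- exact: D0.
- apply: (A) => //; last exact: Z.
  by apply: A => //; exact: Z.
rewrite [leLHS](integral_cst nu mD k%:E).
by rewrite -[leRHS]mule1 lee_wpmul2l ?lee_fin//; exact: probability_le1.
Qed.

(** * Error recursion from one layer to the next *)

Section NetworkStep.
Context (R : realType) (d : nat) (X : set 'rV[R]_d) (cX : compact X) (x0 : X).
Context (sigma : R -> R) (J : R).
Hypotheses (hJ : J.-lipschitz sigma) (sigma0 : sigma 0 = 0).
Context (nu : probability (borel_rV R d) R) (M : R).
Hypothesis hM : (\int[nu]_x (dotv x x)%:E = M%:E)%E.
Context (m : nat) (m_gt0 : (0 < m)%N).

(* The layer above weights the functions sampled in this one by the squares of
   its own coefficients, hence the arbitrary weights [w]. *)
Definition network_bound (k : nat) (H : rkhs R X) (E c : R) :=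
  forall (h : 'I_m -> X -> R) (w : 'I_m -> R),
    (forall i, carrier H (h i)) -> (forall i, 0 <= w i) ->
  exists (z : 'I_m -> 'rV[R]_d) (W : nat -> 'M[R]_m),
    (\int[nu]_(x in X) (\sum_i w i *
       ((preact sigma z W k i x - valL_ 0 (h i) x) ^+ 2
        + c * valL_ 0 (h i) x ^+ 2))%:E
     <= (E * \sum_i w i * ip H (h i) (h i))%:E)%E.

Lemma network_bound_weaken k H (E c E' c' : R) : E <= E' -> c' <= c -> 0 <= c' ->
  forall G, regular_rkhs H G -> network_bound k H E c -> network_bound k H E' c'.
Proof.
move=> EE' cc' c'0 G regH nb h w Hh w0; have [z [W le]] := nb h w Hh w0.
exists z, W; apply: (le_trans (le_trans _ le)); last first.
  rewrite lee_fin ler_wpM2r//; apply: sumr_ge0 => i _.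
  by rewrite mulr_ge0 ?ip_ge0.
have ms (e : R) : measurable_fun (X : set (borel_rV R d)) (fun x : borel_rV R d =>
    \sum_i w i * ((preact sigma z W k i x - valL_ 0 (h i) x) ^+ 2
        + e * valL_ 0 (h i) x ^+ 2)).
  apply: (measurable_funS measurableT) => //.
  apply: measurable_sum => i; apply: measurable_funM => //.
  have mh := measurable_regular cX regH (Hh i).
  apply: measurable_funD; last by apply: measurable_funM => //; exact: measurable_funX.
  apply: measurable_funX; apply: measurable_funB => //.
  exact: measurable_preact hJ.
apply: ge0_le_integral => //.
- exact: compact_borel.
- move=> x _; rewrite lee_fin; apply: sumr_ge0 => i _.
  by rewrite mulr_ge0// addr_ge0 ?sqr_ge0// mulr_ge0 ?sqr_ge0.
- by apply/measurable_EFinP; exact: ms.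
- by apply/measurable_EFinP; exact: ms.
move=> x _; rewrite lee_fin; apply: ler_sum => i _.
by rewrite ler_wpM2l// lerD2l ler_wpM2r// sqr_ge0.
Qed.

(** The first layer realizes linear functions exactly: there is no sampling error, hence no variance
    term either. *)
Lemma network_bound_linear (H : rkhs R X) : is_linear_rkhs H -> network_bound 0 H 0 0.
Proof.
move=> [HE _] h w Hh w0.
have /choice[z hz] i : exists z : 'rV[R]_d, h i = fun x : X => dotv z (set_val x).
  by have := Hh i; rewrite HE.
exists z, (fun=> 0); rewrite mul0r.
rewrite (_ : (\int[nu]_(x in X) _)%E = 0)// -[RHS](integral0 nu X).
apply: eq_integral => x xX; congr (_%:E); apply: big1 => i _.
rewrite -[x]/(set_val (exist _ x xX : X)) valL_set_val hz/=.
by rewrite subrr expr0n mul0r addr0 mulr0.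
Qed.

Context (H H' : rkhs R X) (mu : probability (rkhs_space H) R) (D G : R).
Hypothesis fin : kappa_finite sigma mu.
Hypothesis D0 : 0 <= D.
Hypothesis aeD : \forall g \ae mu, rkhs_norm H (sval g) <= D.
Hypothesis regH : regular_rkhs H G.
Hypothesis G0 : 0 <= G.
Hypothesis HK : has_kernel H' (kappa sigma mu).

Local Notation G' := (J ^+ 2 * D ^+ 2 * G).

(** The three summands are the sampling error of the new layer, the error inherited from below, and
    the loss due to interpolation. The variance term of the sampling, moved to the left side,
    becomes the coefficient [(1 + t) / m]; that of the lower layer is dropped. *)
Lemma network_step k (E c t delta : R) : network_bound k H E c ->
  0 <= E -> 0 <= c -> 0 < t -> 0 < delta ->
  network_bound k.+1 H'
    ((1 + t) * (G' * M) / m%:R + (1 + t^-1) * (J ^+ 2 * D ^+ 2 * E) + delta)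
    ((1 + t) / m%:R).
Proof.
move=> nb E0 c0 t0 delta0 h w Hh w0.
have mR : 0 < m%:R :> R by rewrite ltr0n.
have regH' := regular_next hJ sigma0 fin D0 aeD regH G0 HK.
have M0 : 0 <= M.
  by rewrite -lee_fin -hM; apply: integral_ge0 => x _; rewrite lee_fin dotv_ge0.
have G'0 : 0 <= G' by exact: next_ge0.
set E2 := (1 + t) * (G' * M) / m%:R + (1 + t^-1) * (J ^+ 2 * D ^+ 2 * E).
have ti0 : 0 <= 1 + t^-1 by rewrite addr_ge0// invr_ge0 ltW.
have t1 : 0 <= 1 + t by rewrite addr_ge0// ltW.
have JD0 : 0 <= J ^+ 2 * D ^+ 2 by rewrite mulr_ge0 ?sqr_ge0.
have E20 : 0 <= E2.
  apply: addr_ge0; last by rewrite mulr_ge0// mulr_ge0.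
  by rewrite divr_ge0// mulr_ge0// mulr_ge0.
set c' := (1 + t) / m%:R; have c'0 : 0 <= c' by rewrite divr_ge0.
(* The change of target multiplies [E2] by [1 + s] and adds a multiple of [eta]; [s] and [eta] are
   such that each costs at most [delta / 2]. *)
pose s := delta / (2 * (E2 + 1)); have s0 : 0 < s by rewrite divr_gt0// mulr_gt0// ltr_wpDl.
have si0 : 0 < 1 + s^-1 by rewrite ltr_pwDl// invr_ge0 ltW.
pose eta := delta / (2 * ((1 + s^-1) * (1 + c'))).
have eta0 : 0 < eta by rewrite divr_gt0// mulr_gt0// mulr_gt0// ltr_pwDl.
have [n [p happ]] := feature_approximation hJ sigma0 fin D0 aeD regH G0 HK x0 cX eta0.
have /choice[cf hcf] i := happ (h i) (Hh i).
pose f i := feature_sum sigma mu n (cf i) p.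
(* With this price the penalty, scaled like the sampling error by [(1 + t) / m ^+ 2], equals the
   bound on the inherited error. *)
pose gamma := J ^+ 2 * D ^+ 2 * E * m%:R / t.
have gamma0 : 0 <= gamma.
  by rewrite divr_ge0//; [rewrite mulr_ge0// mulr_ge0|exact: ltW].
have [g [gD Hg]] := layer_sampling cX hJ sigma0 hM fin D0 aeD regH G0 HK n cf p w0 gamma0.
pose a i j := feature_coef sigma n (cf i) p (g j).
pose om (j : 'I_m) := m%:R^-1 * \sum_i w i * a i j ^+ 2.
have om0 j : 0 <= om j.
  by rewrite mulr_ge0 ?invr_ge0//; apply: sumr_ge0 => i _; rewrite mulr_ge0 ?sqr_ge0.
have [z [W leW]] := nb (fun j => sval (g j)) om (fun j => rkhs_elt_carrier (g j)) om0.
(* Level [k.+1] of [preact] reads [W k.+1], and the levels below it read only smaller indices. *)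
pose W' (l : nat) := if l == k.+1 then \matrix_(i, j) a i j else W l.
exists z, W'.
have pW : preact sigma z W' k = preact sigma z W k.
  by apply: preact_eq => l lk; rewrite /W' ltn_eqF.
have pWS i x : preact sigma z W' k.+1 i x =
    m%:R^-1 * \sum_(j < m) a i j * sigma (preact sigma z W k j x).
  rewrite /= pW; congr (_ * _); apply: eq_bigr => j _.
  by rewrite /W' eqxx mxE.
set B := \sum_i w i * ip H' (h i) (h i).
set B' := \sum_i w i * ip H' (f i) (f i).
have B'B : B' <= B.
  by apply: ler_sum => i _; rewrite ler_wpM2l//; have [] := hcf i.
have B'0 : 0 <= B'.
  apply: sumr_ge0 => i _; rewrite mulr_ge0 ?ip_ge0//.
  exact: carrier_feature_sum HK n (cf i) p.
have B0 : 0 <= B by exact: le_trans B'B.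
pose f1 x := \sum_i w i * (\sum_(j < m)
  (a i j * sigma (valL_ 0 (sval (g j) : X -> R) x) - valL_ 0 (f i) x)) ^+ 2.
pose f2 x := \sum_j om j * (preact sigma z W k j x -
  valL_ 0 (sval (g j) : X -> R) x) ^+ 2.
pose f3 x := \sum_i w i * valL_ 0 (f i) x ^+ 2.
have mX : measurable (X : set (borel_rV R d)) by exact: compact_borel.
have mg j : measurable_fun setT (fun x : borel_rV R d => valL_ 0 (sval (g j) : X -> R) x).
  exact: measurable_regular cX regH (rkhs_elt_carrier _).
have mf i : measurable_fun setT (fun x : borel_rV R d => valL_ 0 (f i) x).
  exact: measurable_regular cX regH' (carrier_feature_sum HK n (cf i) p).
have mh i : measurable_fun setT (fun x : borel_rV R d => valL_ 0 (h i) x).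
  exact: measurable_regular cX regH' (Hh i).
have mf1 : measurable_fun setT (f1 : borel_rV R d -> R).
  apply: measurable_sum => i; apply: measurable_funM => //; apply: measurable_funX.
  apply: measurable_sum => j; apply: measurable_funB => //; apply: measurable_funM => //.
  exact: (measurableT_comp (measurable_activation hJ) (mg j)).
have mf2 : measurable_fun setT (f2 : borel_rV R d -> R).
  apply: measurable_sum => i; apply: measurable_funM => //; apply: measurable_funX.
  by apply: measurable_funB => //; exact: measurable_preact hJ.
have mf3 : measurable_fun setT (f3 : borel_rV R d -> R).
  by apply: measurable_sum => i; apply: measurable_funM => //; exact: measurable_funX.
have f10 x : 0 <= f1 x by apply: sumr_ge0 => i _; rewrite mulr_ge0 ?sqr_ge0.
have f20 x : 0 <= f2 x by apply: sumr_ge0 => i _; rewrite mulr_ge0 ?sqr_ge0.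
have f30 x : 0 <= f3 x by apply: sumr_ge0 => i _; rewrite mulr_ge0 ?sqr_ge0.
set V := \sum_(j < m) gamma * \sum_i w i * a i j ^+ 2.
(* Both integrals are finite because the sampling bound is; from here on the computation takes place
   in the reals. *)
have [I1 [I3 [h1 h3 h13]]] : exists I1 I3 : R,
    [/\ (\int[nu]_x (f1 x)%:E = I1%:E)%E, (\int[nu]_x (f3 x)%:E = I3%:E)%E &
        I1 + V + m%:R * I3 <= m%:R * ((G' * M + gamma) * B')].
  have i1 : (0 <= \int[nu]_x (f1 x)%:E)%E by apply: integral_ge0 => x _; rewrite lee_fin.
  have i3 : (0 <= \int[nu]_x (f3 x)%:E)%E by apply: integral_ge0 => x _; rewrite lee_fin.
  move: Hg i1 i3; rewrite -/f1 -/f3 -/V -/B'.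
  case: (\int[nu]_x (f1 x)%:E)%E => [r1| |]//; case: (\int[nu]_x (f3 x)%:E)%E => [r3| |]//.
  - by move=> le13 _ _; exists r1, r3; split => //; rewrite -lee_fin.
  - by rewrite gt0_muley ?lte_fin// addey.
  - by rewrite gt0_muley ?lte_fin// !addye.
have sub (q : borel_rV R d -> R) I : measurable_fun setT q -> (forall x, 0 <= q x) ->
    (\int[nu]_x (q x)%:E = I%:E -> \int[nu]_(x in X) (q x)%:E <= I%:E)%E.
  move=> mq q0 <-; apply: ge0_subset_integral => //; first exact/measurable_EFinP.
  by move=> x _; rewrite lee_fin.
have h2 : (\int[nu]_(x in X) (f2 x)%:E <= (E * (D ^+ 2 * \sum_j om j))%:E)%E.
  apply: (@le_trans _ _ (E * \sum_j om j * ip H (sval (g j)) (sval (g j)))%:E).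
    apply: le_trans leW; apply: ge0_le_integral => //.
    - by move=> x _; rewrite lee_fin.
    - by apply/measurable_EFinP; exact: measurable_funTS.
    - apply/measurable_EFinP/measurable_funTS; apply: measurable_sum => j.
      apply: measurable_funM => //; apply: measurable_funD; last first.
        by apply: measurable_funM => //; exact: measurable_funX.
      by apply: measurable_funX; apply: measurable_funB => //; exact: measurable_preact hJ.
    - move=> x _; rewrite lee_fin; apply: ler_sum => j _.
      by rewrite ler_wpM2l// lerDl mulr_ge0 ?sqr_ge0.
  rewrite lee_fin ler_wpM2l// mulr_sumr ler_sum// => j _.
  by rewrite mulrC ler_wpM2r.
have := @integral_lin3_le _ _ _ nu X f1 f2 f3
  ((1 + s) * ((1 + t) * m%:R^-1 ^+ 2)) ((1 + s) * ((1 + t^-1) * J ^+ 2))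
  ((1 + s) * c') ((1 + s^-1) * (1 + c') * (eta * B)) I1 _ I3 mX
  (measurable_funTS mf1) (measurable_funTS mf2) (measurable_funTS mf3)
  f10 f20 f30 _ _ _ _ (sub _ _ mf1 f10 h1) h2 (sub _ _ mf3 f30 h3).
have s1 : 0 <= 1 + s by rewrite addr_ge0// ltW.
have kB0 : 0 <= (1 + s^-1) * (1 + c') * (eta * B).
  by apply: mulr_ge0; apply: mulr_ge0 => //; [exact: ltW|rewrite addr_ge0|exact: ltW].
have q1 : 0 <= (1 + s) * ((1 + t) * m%:R^-1 ^+ 2) by rewrite mulr_ge0// mulr_ge0// sqr_ge0.
have q2 : 0 <= (1 + s) * ((1 + t^-1) * J ^+ 2) by rewrite mulr_ge0// mulr_ge0// sqr_ge0.
have q3 : 0 <= (1 + s) * c' by rewrite mulr_ge0.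
move=> /(_ q1 q2 q3 kB0) lin; apply: (le_trans (le_trans _ lin)).
  apply: ge0_le_integral => //.
  - move=> x _; rewrite lee_fin; apply: sumr_ge0 => i _.
    by rewrite mulr_ge0// addr_ge0 ?sqr_ge0// mulr_ge0 ?sqr_ge0.
  - apply/measurable_EFinP/measurable_funTS; apply: measurable_sum => i.
    apply: measurable_funM => //; apply: measurable_funD; last first.
      by apply: measurable_funM => //; exact: measurable_funX.
    by apply: measurable_funX; apply: measurable_funB => //; exact: measurable_preact hJ.
  - apply/measurable_EFinP/measurable_funTS; apply: measurable_funD => //.
    by do ?[apply: measurable_funD]; apply: measurable_funM.
  move=> x Xx; rewrite lee_fin.
  apply: (le_trans (change_target_le _ (fun i => valL_ 0 (f i) x) _ s0 c'0 w0)).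
  apply: lerD; last first.
    rewrite ler_wpM2l//; first by rewrite mulr_ge0 ?(ltW si0)// addr_ge0.
    rewrite /B mulr_sumr ler_sum// => i _; rewrite [leRHS]mulrCA ler_wpM2l//.
    rewrite -[x]/(set_val (exist _ x (mem_set Xx) : X)) !valL_set_val.
    by have [_] := hcf i; apply.
  rewrite -[(1 + s) * _ * f1 x]mulrA -[(1 + s) * _ * f2 x]mulrA
    -[(1 + s) * _ * f3 x]mulrA -!mulrDr ler_wpM2l// lerD2r.
  under eq_bigr do rewrite pWS.
  exact: perturbed_layer_le.
rewrite lee_fin; set S := \sum_j om j.
have VS : V = gamma * (m%:R * S).
  by rewrite /V /S -!mulr_sumr mulVKf// gt_eqF.
have t_neq0 : t != 0 by rewrite gt_eqF.
have m_neq0 : m%:R != 0 :> R by rewrite gt_eqF.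
(* By the choice of [gamma], the three terms recombine into the quantity bounded by [h13]. *)
have -> : (1 + s) * ((1 + t) * m%:R^-1 ^+ 2) * I1 +
    (1 + s) * ((1 + t^-1) * J ^+ 2) * (E * (D ^+ 2 * S)) + (1 + s) * c' * I3 =
    (1 + s) * ((1 + t) * m%:R^-1 ^+ 2) * (I1 + V + m%:R * I3).
  by rewrite VS /gamma /c'; field; rewrite t_neq0 m_neq0.
have le1 := ler_wpM2l q1 h13.
have E2B' : (1 + s) * ((1 + t) * m%:R^-1 ^+ 2) * (m%:R * ((G' * M + gamma) * B')) =
    (1 + s) * E2 * B'.
  by rewrite /E2 /gamma; field; rewrite t_neq0 m_neq0.
rewrite E2B' in le1.
have le2 : (1 + s) * E2 * B' <= (1 + s) * E2 * B by rewrite ler_wpM2l// mulr_ge0.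
have -> : (1 + s^-1) * (1 + c') * (eta * B) = delta / 2 * B.
  have : (1 + s^-1) * (1 + c') != 0 by rewrite mulf_neq0// gt_eqF// ltr_pwDl.
  by rewrite /eta; set Q := (1 + s^-1) * _ => Q0; field.
have le3 : s * E2 <= delta / 2.
  have E21 : 0 < E2 + 1 by rewrite ltr_wpDl.
  have -> : s * E2 = delta / 2 * (E2 / (E2 + 1)) by rewrite /s; field; rewrite gt_eqF.
  rewrite ler_piMr// ?divr_ge0 ?(ltW delta0)//.
  by rewrite ler_pdivrMr// mul1r lerDl.
have le4 := ler_wpM2r B0 le3.
rewrite [leRHS]mulrDl; apply: (@le_trans _ _ ((1 + s) * E2 * B + delta / 2 * B)).
  by rewrite lerD2r; exact: le_trans le2.
by rewrite [(1 + s) * E2]mulrDl mul1r mulrDl; lra.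
Qed.

End NetworkStep.

(** * Ladders *)

Section Ladders.
Context (R : realType) (d : nat) (X : set 'rV[R]_d) (cX : compact X) (x0 : X).
Context (sigma : R -> R) (J : R).
Hypotheses (hJ : J.-lipschitz sigma) (sigma0 : sigma 0 = 0).

Lemma D_infty_ge0 (H H' : rkhs R X) : (0 <= D_infty sigma H H')%E.
Proof.
apply: le_ereal_inf_tmp => _ [mu _ <-]; apply: ess_sup_gee.
  exact: (eq_ind_r (fun z => 0 < z)%E lte01 (probability_setT mu)).
by apply: nearW => g; rewrite lee_fin sqrtr_ge0.
Qed.

Lemma D_infty_lt (H H' : rkhs R X) (D : R) : (D_infty sigma H H' < D%:E)%E ->
  exists mu : probability (rkhs_space H) R, [/\ kappa_finite sigma mu,
    has_kernel H' (kappa sigma mu) & \forall g \ae mu, rkhs_norm H (sval g) <= D].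
Proof.
move=> /ereal_inf_lt[_ [mu [fin HK] <-]] muD; exists mu; split => //.
have : (rkhs_ess_norm mu <= D%:E)%E by exact: ltW.
move=> /ess_supP; apply: ae_sub => g; by rewrite lee_fin.
Qed.

Context (nu : probability (borel_rV R d) R) (M : R).
Hypothesis hM : (\int[nu]_x (dotv x x)%:E = M%:E)%E.
Context (m : nat) (m_gt0 : (0 < m)%N).
Context (L : nat) (Hs : nat -> rkhs R X) (D : nat -> R).
Hypothesis lin : is_linear_rkhs (Hs 1%N).
Hypothesis D0 : forall l, 0 <= D l.
Hypothesis HsD : forall l, (1 <= l < L)%N ->
  (D_infty sigma (Hs l) (Hs l.+1) < (D l)%:E)%E.

(** The regularity constant of [Hs k.+1], the space that corresponds to level [k] of [preact]. *)
Let G k := J ^+ (2 * k) * \prod_(1 <= l < k.+1) D l ^+ 2.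

(** Iterates [network_step]. At [t = k] the new constant would be [(1 + k) + (1 + 1/k) * k ^+ 2],
    that is the square of [k + 1]; the strict inequality on [E] leaves room for the losses. *)
Lemma ladder_network_bound k : (k < L)%N -> [/\ 0 <= G k,
  regular_rkhs (Hs k.+1) (G k) &
  forall E, k%:R ^+ 2 * (G k * M) / m%:R < E ->
    network_bound sigma nu m k (Hs k.+1) E (k%:R / m%:R)].
Proof.
have mR : 0 < m%:R :> R by rewrite ltr0n.
elim: k => [_|k IH kL].
  rewrite /G muln0 expr0 big_nil mulr1; split => //; first exact: regular_linear.
  move=> E; rewrite expr0n/= !mul0r => E0.
  apply: (@network_bound_weaken _ _ _ cX _ _ hJ _ _ _ _ 0 0 _ _
    _ _ _ _ (regular_linear lin)) => //; first exact: ltW.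
  exact: (@network_bound_linear _ _ _ sigma nu m _ lin).
have [G0 regk nbk] := IH (ltnW kL).
have [mu [fin HK aeD]] := D_infty_lt (HsD (kL : (1 <= k.+1 < L)%N)).
have GS : G k.+1 = J ^+ 2 * D k.+1 ^+ 2 * G k.
  by rewrite /G big_nat_recr//= mulnS exprD; ring.
have G'0 : 0 <= G k.+1 by rewrite GS; exact: next_ge0.
have regk1 : regular_rkhs (Hs k.+2) (G k.+1).
  by rewrite GS; exact (regular_next hJ sigma0 fin (D0 _) aeD regk G0 HK).
split => // E hE.
have M0 : 0 <= M.
  by rewrite -lee_fin -hM; apply: integral_ge0 => x _; rewrite lee_fin dotv_ge0.
set A := G k.+1 * M / m%:R.
have A0 : 0 <= A by rewrite divr_ge0// mulr_ge0.
(* One third of the gap each pays for [t] exceeding [k], for the excess [eps] of the lower bound,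
   and for [delta]. *)
pose gap := E - k.+1%:R ^+ 2 * A.
have gap0 : 0 < gap by rewrite subr_gt0 /A mulrA.
pose tau := gap / (3 * (A + 1)).
have A10 : 0 < A + 1 by rewrite ltr_wpDl.
have tau0 : 0 < tau by rewrite divr_gt0// mulr_gt0.
(* The shift [tau] makes [t] positive also for [k = 0]. *)
pose t := k%:R + tau; have t0 : 0 < t by rewrite ltr_wpDl.
pose Q := (1 + t^-1) * (J ^+ 2 * D k.+1 ^+ 2).
have Q0 : 0 <= Q.
  by apply: mulr_ge0; [rewrite addr_ge0// invr_ge0 ltW|rewrite mulr_ge0 ?sqr_ge0].
have Q10 : 0 < Q + 1 by rewrite ltr_wpDl.
pose eps := gap / (3 * (Q + 1)).
have eps0 : 0 < eps by rewrite divr_gt0// mulr_gt0.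
pose E1 := k%:R ^+ 2 * (G k * M) / m%:R + eps.
have E10 : 0 <= E1.
  by rewrite addr_ge0 ?(ltW eps0)// divr_ge0// mulr_ge0 ?sqr_ge0// mulr_ge0.
have nb1 : network_bound sigma nu m k (Hs k.+1) E1 (k%:R / m%:R).
  by apply: nbk; rewrite ltrDl.
have c0 : 0 <= k%:R / m%:R :> R by rewrite divr_ge0.
have d0 : 0 < gap / 3 by rewrite divr_gt0.
apply: (@network_bound_weaken _ _ _ cX _ _ hJ _ _ _ _ _ _ _ _ _ _ _ _ regk1
  (@network_step _ _ _ cX x0 _ _ hJ sigma0 _ _ hM _ m_gt0 _ _ _ _ _ fin (D0 _) aeD
    regk G0 HK _ _ _ _ _ nb1 E10 c0 t0 d0)); last 2 first.
- by rewrite ler_wpM2r ?invr_ge0// -natr1 addrC lerD2l lerDl ltW.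
- exact: divr_ge0.
have -> : (1 + t) * (J ^+ 2 * D k.+1 ^+ 2 * G k * M) / m%:R = (1 + t) * A.
  by rewrite -GS /A; ring.
have -> : (1 + t^-1) * (J ^+ 2 * D k.+1 ^+ 2 * E1) =
    (1 + t^-1) * k%:R ^+ 2 * A + Q * eps.
  by rewrite /A GS /E1 /Q; ring.
have h1 : (1 + t^-1) * k%:R ^+ 2 * A <= (k%:R ^+ 2 + k%:R) * A.
  rewrite ler_wpM2r// mulrDl mul1r lerD2l mulrC ler_pdivrMr// expr2.
  by rewrite ler_wpM2l// lerDl ltW.
have h2 : tau * A <= gap / 3.
  have -> : tau * A = gap / 3 * (A / (A + 1)) by rewrite /tau; field; rewrite gt_eqF.
  by rewrite ler_piMr ?(ltW d0)// ler_pdivrMr// mul1r lerDl.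
have h3 : Q * eps <= gap / 3.
  have -> : Q * eps = gap / 3 * (Q / (Q + 1)) by rewrite /eps; field; rewrite gt_eqF.
  by rewrite ler_piMr ?(ltW d0)// ler_pdivrMr// mul1r lerDl.
have -> : E = gap + (k%:R + 1) ^+ 2 * A by rewrite /gap -natr1; ring.
have -> : (1 + t) * A = (1 + k%:R) * A + tau * A by rewrite /t; ring.
rewrite (_ : (k%:R + 1) ^+ 2 * A = (k%:R ^+ 2 + k%:R) * A + (1 + k%:R) * A); last by ring.
lra.
Qed.

End Ladders.

(** * Nearly optimal ladders *)

Section NearOptimalLadder.
Context (R : realType).

(** Each factor has to be taken strictly above an infimum that may not be attained; by continuity of
    the product this costs as little as desired. *)
Lemma prod_shift_lt (s : seq nat) (a : nat -> R) (e : R) : 0 < e ->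
  exists2 r, 0 < r & \prod_(l <- s) (a l + r) < \prod_(l <- s) a l + e.
Proof.
move=> e0.
have c : (fun r => \prod_(l <- s) (a l + r)) @ (0 : R)^'+ --> \prod_(l <- s) a l.
  elim: s => [|l s IH].
    rewrite big_nil; under eq_fun do rewrite big_nil; exact: cvg_cst.
  rewrite big_cons; under eq_fun do rewrite big_cons.
  apply: cvgM => //; rewrite -[X in _ --> X]addr0.
  apply: cvgD; first exact: cvg_cst.
  by apply: cvg_at_right_filter; exact: cvg_id.
have : \forall r \near (0 : R)^'+, 0 < r /\ \prod_(l <- s) (a l + r) < \prod_(l <- s) a l + e.
  near=> r; split; first by near: r; exact: nbhs_right_gt.
  by near: r; apply: (cvgr_lt _ c); rewrite ltrDl.
by move=> /filter_ex[r []]; exists r.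
Unshelve. all: by end_near. Qed.

Lemma prod_EFin_fine (I : Type) (s : seq I) (P : pred I) (F : I -> \bar R) :
  (forall i, P i -> F i \is a fin_num) ->
  (\prod_(i <- s | P i) F i)%E = (\prod_(i <- s | P i) fine (F i))%:E.
Proof.
move=> Ff; elim: s => [|i s IH]; first by rewrite !big_nil.
by rewrite !big_cons; case: ifPn => // Pi; rewrite EFinM IH fineK// Ff.
Qed.

Context (d : nat) (X : set 'rV[R]_d) (sigma : R -> R) (L : nat).

Lemma D_ladder_ge0 (H : rkhs R X) : (0 <= D_ladder sigma L H)%E.
Proof.
apply: le_ereal_inf_tmp => _ [Hs _ <-].
by apply: prode_ge0 => l _; exact: D_infty_ge0.
Qed.

Lemma C_infty_ge0 (f : X -> R) : (0 <= C_infty sigma L f)%E.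
Proof.
apply: le_ereal_inf_tmp => _ [H _ <-].
by rewrite mule_ge0 ?D_ladder_ge0// lee_fin sqrtr_ge0.
Qed.

Lemma near_optimal_ladder (f : X -> R) (C : R) : (C_infty sigma L f < C%:E)%E ->
  exists (Hs : nat -> rkhs R X) (D : nat -> R),
    [/\ is_linear_rkhs (Hs 1%N), carrier (Hs L) f, forall l, 0 <= D l,
      forall l, (1 <= l < L)%N -> (D_infty sigma (Hs l) (Hs l.+1) < (D l)%:E)%E &
      rkhs_norm (Hs L) f * \prod_(1 <= l < L) D l < C].
Proof.
move=> /ereal_inf_lt[_ [H [Hf DH] <-]] HC.
set N := rkhs_norm H f in HC; have N0 : 0 <= N by exact: sqrtr_ge0.
have /fineK DE : D_ladder sigma L H \is a fin_num.
  by rewrite ge0_fin_numE// D_ladder_ge0.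
set dl := fine _ in DE; rewrite -DE -EFinM lte_fin in HC.
(* Spent twice, on the choice of the ladder and on the enlargement of its factors; the total loss
   [2 * N * eta] stays below [C - N * dl], also for [N = 0]. *)
pose eta := (C - N * dl) / (2 * (N + 1)).
have N10 : 0 < N + 1 by rewrite ltr_wpDl.
have eta0 : 0 < eta by rewrite divr_gt0 ?subr_gt0// mulr_gt0.
have : (D_ladder sigma L H < (dl + eta)%:E)%E by rewrite -DE lte_fin ltrDl.
move=> /ereal_inf_lt[_ [Hs [lin HsL HsD] <-]].
pose a l := fine (D_infty sigma (Hs l) (Hs l.+1)).
have a_ge0 l : 0 <= a l by rewrite fine_ge0// D_infty_ge0.
have fina l : (1 <= l < L)%N -> D_infty sigma (Hs l) (Hs l.+1) \is a fin_num.
  by move=> lL; rewrite ge0_fin_numE ?D_infty_ge0// HsD.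
rewrite big_nat prod_EFin_fine// lte_fin -big_nat => dle.
have [r r0 hr] := prod_shift_lt (index_iota 1 L) a eta0.
exists Hs, (fun l => a l + r); split => //.
- by rewrite HsL.
- by move=> l; rewrite addr_ge0// ltW.
- by move=> l lL; rewrite -[ltLHS]fineK ?fina// lte_fin ltrDl.
rewrite HsL -/N; apply: (@le_lt_trans _ _ (N * (dl + eta + eta))).
  by rewrite ler_wpM2l// ltW// (lt_trans hr)// ltrD2r.
have -> : N * (dl + eta + eta) = N * dl + (C - N * dl) * (N / (N + 1)).
  by rewrite /eta; field; rewrite gt_eqF.
rewrite -ltrBrDl gtr_pMr ?subr_gt0//.
by rewrite ltr_pdivrMr// mul1r ltrDl.
Qed.

End NearOptimalLadder.

(** * Absorption of the losses by the variance term *)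

Theorem theorem9 (R : realType) (d : nat) (X : set 'rV[R]_d) (hX : compact X)
    (sigma : R -> R) (J : R) (L : nat) (hL : (2 <= L)%N)
    (hJ : J.-lipschitz sigma) (hsigma0 : sigma 0 = 0)
    (nu : probability (borel_rV R d) R) (hnu : nu X = 1%E)
    (Mnu : R)
    (hMnu : (\int[nu]_x ((euclid_norm x ^+ 2)%:E))%E = Mnu%:E)
    (f : X -> R) (hf : F_infty sigma L f) (m : nat) (hm : (1 <= m)%N) :
  exists fm : 'rV[R]_d -> R, is_network sigma L m fm /\
    (\int[nu]_(x in X) ((`|fm x - valL_ 0 f x| ^+ 2)%:E) <=
     (L.-1%:R ^+ 2 * J ^+ (2 * L - 2) * Mnu / m%:R)%:E * C_infty sigma L f ^+ 2)%E.
Proof.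
case: L hL hf => [//|[//|K]] _ hf; rewrite -[K.+2.-1]/(K.+1).
have hM : (\int[nu]_x (dotv x x)%:E = Mnu%:E)%E.
  by rewrite -hMnu; apply: eq_integral => x _; rewrite sqr_sqrtr// dotv_ge0.
have M0 : 0 <= Mnu.
  by rewrite -lee_fin -hM; apply: integral_ge0 => x _; rewrite lee_fin dotv_ge0.
have mR : 0 < m%:R :> R by rewrite ltr0n.
have [x0] : exists x : X, True.
  have /set0P[x Xx] : X != set0.
    by apply/eqP => X0; move: hnu; rewrite X0 measure0 => /eqP; rewrite eqe eq_sym oner_eq0.
  by exists (exist _ x (mem_set Xx)).
move=> _.
have /fineK : C_infty sigma K.+2 f \is a fin_num by rewrite ge0_fin_numE// C_infty_ge0.
set C := fine _ => CE.
have C0 : 0 <= C by rewrite fine_ge0// C_infty_ge0.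
set Q := K.+1%:R ^+ 2 * J ^+ (2 * K.+2 - 2) * Mnu / m%:R.
have QE : Q = K.+1%:R ^+ 2 * J ^+ (2 * K.+1) * Mnu / m%:R.
  by rewrite /Q mulnS addKn.
have J0 : 0 <= J ^+ (2 * K.+1) by rewrite exprM exprn_ge0// sqr_ge0.
have Q0 : 0 <= Q by rewrite QE divr_ge0// mulr_ge0// mulr_ge0// sqr_ge0.
rewrite -CE -EFin_expe -EFinM.
(* Without a positive second moment there is no variance term to absorb the losses, but then the
   zero network is exact. *)
have [f_null|f_pos] := eqVneq (\int[nu]_(x in X) (valL_ 0 f x ^+ 2)%:E)%E 0%E.
  exists (fun=> 0); split.
    exists (fun=> 0), (fun=> 0), (fun=> 0) => x.
    by rewrite big1 ?mulr0// => i _; rewrite mul0r.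
  under eq_integral do rewrite sub0r normrN real_normK ?num_real//.
  by rewrite f_null lee_fin mulr_ge0// sqr_ge0.
(* Only a positive real lower bound is used, so an infinite integral needs no exclusion. *)
have [phi phi0 phi_le] : exists2 phi, 0 < phi &
    (phi%:E <= \int[nu]_(x in X) (valL_ 0 f x ^+ 2)%:E)%E.
  have : (0 < \int[nu]_(x in X) (valL_ 0 f x ^+ 2)%:E)%E.
    by rewrite lt0e f_pos integral_ge0// => x _; rewrite lee_fin sqr_ge0.
  case: (\int[nu]_(x in X) _)%E => [r| |]//.
    by rewrite lte_fin => r0; exists r.
  by move=> _; exists 1; rewrite ?leey.
pose c := K.+1%:R / m%:R : R; have c0 : 0 < c by rewrite divr_gt0.
(* Half of the variance term: one half pays for replacing [C] by [C + e], the other for the excess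
   of [E] over [Q * P ^+ 2]. *)
pose gap := c * phi / 2; have gap0 : 0 < gap by rewrite divr_gt0// mulr_gt0.
have QC0 : 0 <= Q * (2 * C + 1) by rewrite mulr_ge0// addr_ge0// mulr_ge0.
(* Ensures [Q * (2 * C + 1) * e <= gap] together with [e <= 1], which bounds [e ^+ 2] by [e]; the
   denominator is positive even for [Q = 0]. *)
pose e := gap / (Q * (2 * C + 1) + gap).
have den0 : 0 < Q * (2 * C + 1) + gap by rewrite ltr_wpDl.
have e0 : 0 < e by rewrite divr_gt0.
have e1 : e <= 1 by rewrite ler_pdivrMr// mul1r lerDr.
have Qe : Q * (C + e) ^+ 2 <= Q * C ^+ 2 + gap.
  have h1 : Q * (2 * C + 1) * e <= gap.
    rewrite /e mulrA ler_pdivrMr// mulrC ler_wpM2l ?(ltW gap0)//.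
    by rewrite lerDl ltW.
  have h2 : e ^+ 2 <= e by rewrite expr2 ler_piMl// ltW.
  have h3 := ler_wpM2l Q0 h2.
  have -> : Q * (C + e) ^+ 2 = Q * C ^+ 2 + (Q * (2 * C + 1) * e + (Q * e ^+ 2 - Q * e)).
    by ring.
  by rewrite lerD2l; lra.
have : (C_infty sigma K.+2 f < (C + e)%:E)%E by rewrite -CE lte_fin ltrDl.
move=> /near_optimal_ladder[Hs [D [lin Hf D0 HsD]]].
set N := rkhs_norm _ f; set P := \prod_(_ <= _ < _) _ => NP.
have N0 : 0 <= N by exact: sqrtr_ge0.
have P0 : 0 <= P by apply: prodr_ge0.
have [_ regL nb] := ladder_network_bound hX x0 hJ hsigma0 hM hm lin D0 HsD (ltnSn K.+1).
pose E := Q * P ^+ 2 + gap / (N ^+ 2 + 1).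
have N10 : 0 < N ^+ 2 + 1 by rewrite ltr_wpDl// sqr_ge0.
(* All targets are [f], and the weights single out one unit of the top level. *)
have {nb} [] := nb E _ (fun=> f) (fun i => (i == Ordinal hm)%:R).
- rewrite prodrXl -/P.
  have -> : K.+1%:R ^+ 2 * (J ^+ (2 * K.+1) * P ^+ 2 * Mnu) / m%:R = Q * P ^+ 2.
    by rewrite QE; ring.
  by rewrite /E ltrDl divr_gt0.
- by [].
- by [].
move=> z [W]; set i0 := Ordinal hm.
have pick (F : 'I_m -> R) : \sum_i (i == i0)%:R * F i = F i0.
  rewrite (bigD1 i0)// eqxx mul1r big1 => [|i /negbTE ->]; last exact: mul0r.
  exact: addr0.
under eq_integral do rewrite pick.
rewrite pick -rkhs_normE// -/N -/c => leW.
(* The pre-activation of that unit is itself the output of a network, with row [i0] of the last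
   matrix as output weights. *)
exists (preact sigma z W K.+1 i0); split.
  by exists z, W, (W K.+1 i0) => x.
have mf : measurable_fun setT (fun x : borel_rV R d => valL_ 0 f x).
  exact: measurable_regular hX regL Hf.
have mX : measurable (X : set (borel_rV R d)) by exact: compact_borel.
under eq_integral do rewrite real_normK ?num_real//.
move: leW; under eq_integral do rewrite EFinD (EFinM c).
have mf2 : measurable_fun (X : set (borel_rV R d)) (fun x : borel_rV R d => valL_ 0 f x ^+ 2).
  exact: (measurable_funTS (measurable_funX _ mf)).
rewrite ge0_integralD//; last 4 first.
- by move=> x _; rewrite lee_fin sqr_ge0.
- apply/measurable_EFinP/measurable_funTS; apply: measurable_funX.
  by apply: measurable_funB => //; exact: measurable_preact hJ.
- by move=> x _; rewrite -EFinM lee_fin mulr_ge0 ?sqr_ge0// ltW.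
- by under eq_fun do rewrite -EFinM; apply/measurable_EFinP; exact: measurable_funM.
rewrite ge0_integralZl_EFin ?(ltW c0)//; last 2 first.
- by move=> x _; rewrite lee_fin sqr_ge0.
- exact/measurable_EFinP.
set I := (\int[nu]_(x in X) _)%E => leW.
have : (I + (c * phi)%:E <= (E * N ^+ 2)%:E)%E.
  apply: le_trans leW; rewrite leeD2l// EFinM.
  by rewrite lee_wpmul2l// lee_fin ltW.
rewrite -leeBrDr// -EFinB => /le_trans; apply; rewrite lee_fin.
have NP2 : Q * (N * P) ^+ 2 <= Q * (C + e) ^+ 2.
  by rewrite ler_wpM2l// ler_sqr ?nnegrE ?mulr_ge0 ?addr_ge0 ?(ltW e0)// ltW.
have gapN : gap / (N ^+ 2 + 1) * N ^+ 2 <= gap.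
  by rewrite mulrAC ler_pdivrMr// ler_wpM2l ?(ltW gap0)// lerDl.
have -> : c * phi = gap + gap by rewrite /gap; field.
have -> : E * N ^+ 2 = Q * (N * P) ^+ 2 + gap / (N ^+ 2 + 1) * N ^+ 2.
  by rewrite /E mulrDl; ring.
lra.
Qed.
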